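(* Let $X$ be a random variable with an arbitrary distribution on the open interval $]0,1[$, let $r_0>0$ and $T>0$, and let $R=(R_t,\ t\ge 0)$ be the record process with factor $X$ and initial state $R_0=r_0$. Let $s_*$ be the unique positive solution of the equation $$\mathbb{E}\left[\frac{e^{s(1-X)}-1}{1-X}\right]=1 .$$ Then the policy $\pi_{s_*}$, which stops at the first record time $t<T$ such that $(T-t)R_t\le s_*$, is optimal: it maximises the probability $$\mathbb{P}(R_{\pi-}>R_\pi=R_T,\ \pi<T)$$ of recognising the last record before $T$ over all stopping times $\pi$ adapted to the natural right-continuous filtration of $R$.
   Context: The record process with factor $X$ is the nonincreasing right-continuous Markov jump process $R=(R_t,\ t\ge0)$ which, when in state $r>0$, jumps at rate $r$ to a new state $rX'$, where $X'$ is a fresh independent copy of $X$. Equivalently, starting from $R_0=r_0$, the successive states after the jumps are $r_0X_1,\ r_0X_1X_2,\ldots$ and the successive sojourn times (in $r_0$, in $r_0X_1$, in $r_0X_1X_2$, and so on) are $E_1/r_0,\ E_2/(r_0X_1),\ E_3/(r_0X_1X_2),\ldots$, where the $X_j$ are i.i.d. copies of $X$ and the $E_j$ are i.i.d. unit exponential variables independent of the $X_j$. A record occurs at time $t>0$ if $t$ is a jump time of $R$; time $0$ is not a record time. Here $R_{t-}$ denotes the left limit. A policy is a stopping time $\pi$ (possibly taking the value $\infty$, meaning that it never stops) with respect to the natural right-continuous filtration of $R$. It recognises the last record before the horizon $T$ if $\pi<T$, $\pi$ is a record time and no record occurs in $]\pi,T]$, i.e. if $R_{\pi-}>R_\pi=R_T$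 and $\pi<T$. If there is no record time $t<T$ with $(T-t)R_t\le s_*$, the policy $\pi_{s_*}$ does not stop (it does not succeed). *)

(* Defs.v *)
From HB Require Import structures.
From mathcomp Require Import all_boot all_order all_algebra finmap.
From mathcomp Require Import all_classical all_reals all_analysis.

Set Implicit Arguments.
Unset Strict Implicit.
Unset Printing Implicit Defensive.

Import Order.TTheory GRing.Theory Num.Theory.
Import numFieldNormedType.Exports.

Local Open Scope classical_set_scope.
Local Open Scope ring_scope.

Definition mutually_independent d (Omega : measurableType d) (R : realType)
    (P : probability Omega R) (I : choiceType) (Z : I -> {RV P >-> R}) : Prop :=
  forall (J : {fset I}) (A : I -> set R),
    (forall i, measurable (A i)) ->
    P (\bigcap_(i in [set` J]) (Z i @^-1` A i)) =
      (\prod_(i <- J) P (Z i @^-1` A i))%E.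

Section paths.
Context {R : realType}.
Implicit Types (f : R -> R) (x e : nat -> R) (r t : R).

Definition record_state r x (k : nat) : R := r * \prod_(j < k) x j.

(* The [k]-th jump time is the sum of the first [k] sojourn times; in
   particular the "zeroth" one is the origin of time. *)
Definition record_time r x e (k : nat) : R :=
  \sum_(j < k) (e j / record_state r x j).

(* Right-continuous piecewise constant paths on [0, +oo[ whose jump times do
   not accumulate.  The [u k] need not be actual discontinuities, so that
   paths with finitely many jumps are allowed. *)
Definition jump_path f : Prop :=
  exists u : nat -> R,
    [/\ u 0%N = 0,
        {homo u : m n / (m <= n)%N >-> m <= n},
        u n @[n --> \oo] --> +oo &
        forall k t, u k <= t < u k.+1 -> f t = f (u k)].

Definition left_limit f t : R := lim (f s @[s --> t^'-]).

Definition is_record f t : Prop := 0 < t /\ f t < left_limit f t.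

End paths.

(* [Rp t] is the state at time [t], and is meaningful for [0 <= t] only.
   Every path has the regularity of a jump path; the sequential description
   through the factors [X_ j] and the clocks [E_ j] is required almost surely,
   since the [X_ j] may leave ]0,1[, and the [E_ j] may fail to be positive or
   to make the jump times diverge, on a null set. *)
Record is_record_process d (Omega : measurableType d) d'
    (Omega' : measurableType d') (R : realType) (P : probability Omega R)
    (Q : probability Omega' R) (X : {RV Q >-> R}) (r0 : R)
    (Rp : R -> {RV P >-> R}) : Prop := {
  rp_init : forall w, Rp 0 w = r0 ;
  rp_gt0 : forall w t, 0 <= t -> 0 < Rp t w ;
  rp_noninc : forall w s t, 0 <= s -> s <= t -> Rp t w <= Rp s w ;
  rp_jump : forall w, jump_path (Rp ^~ w) ;
  rp_law : exists X_ E_ : nat -> {RV P >-> R},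
    [/\ forall j A, measurable A -> distribution P (X_ j) A = distribution Q X A,
        forall j A, measurable A ->
          distribution P (E_ j) A = exponential_prob 1 A,
        mutually_independent
          (fun i : nat + nat => match i with inl j => X_ j | inr j => E_ j end) &
        {ae P, forall w, forall k t,
          record_time r0 (X_ ^~ w) (E_ ^~ w) k <= t
            < record_time r0 (X_ ^~ w) (E_ ^~ w) k.+1 ->
          Rp t w = record_state r0 (X_ ^~ w) k}]
}.

Section policies.
Context d (Omega : measurableType d) (R : realType).
Implicit Types (Rp : R -> Omega -> R) (pi : Omega -> \bar R) (T s t : R).

Definition natural_filtration Rp t : set (set Omega) :=
  <<s \bigcup_(u in `[0, t]) preimage_set_system setT (Rp u) measurable >>.

Definition right_filtration Rp t : set (set Omega) :=
  \bigcap_(u in `]t, +oo[) natural_filtration Rp u.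

Definition stopping_time Rp pi : Prop :=
  (forall w, (0 <= pi w)%E) /\
  (forall t, 0 <= t -> right_filtration Rp t [set w | (pi w <= t%:E)%E]).

(* The event R_{pi-} > R_pi = R_T, pi < T, where [is_record] also excludes
   stopping at time 0. *)
Definition recognises_last_record Rp T pi : set Omega :=
  [set w | exists t : R, [/\ pi w = t%:E, is_record (Rp ^~ w) t,
                             Rp t w = Rp T w & t < T]].

(* The infimum is attained when the set is nonempty, because the jump times of
   a jump path do not accumulate; it is +oo when the set is empty. *)
Definition threshold_policy Rp T s : Omega -> \bar R := fun w =>
  ereal_inf [set t%:E | t in
    [set t | [/\ is_record (Rp ^~ w) t, t < T & (T - t) * Rp t w <= s]]].

Definition optimal_policy (P : probability Omega R) Rp T pi : Prop :=
  stopping_time Rp pi /\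
  forall pi', stopping_time Rp pi' ->
    (P (recognises_last_record Rp T pi') <=
     P (recognises_last_record Rp T pi))%E.

End policies.

Definition is_threshold d' (Omega' : measurableType d') (R : realType)
    (Q : probability Omega' R) (X : {RV Q >-> R}) (s : R) : Prop :=
  0 < s /\ ('E_Q[(fun w => (expR (s * (1 - X w)) - 1) / (1 - X w))%R] = 1)%E.

(* Main.v *)
(* With s = (T - t) R_t, call s the scaled remaining time: at a record it is
   the last one with probability exp(-s), and exactly one more record follows
   with probability exp(-s) phi(s), where phi(s) = E[(exp(s(1-X))-1)/(1-X)] is
   increasing and phi(s_* ) = 1.  Write L_k for the event that the k-th record
   is the last one before T and tau_k for its time.  For an event A known at
   tau_k, let D_k(A) = P(A, L_k) - P(A, L_{k+1}), the integral over A of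
   exp(-s)(1 - phi(s)).  Its integrand has the sign of s_* - s, so D_k(A) is
   largest when A = B_k = {tau_k < T, s <= s_*}.  If pi is a policy and
   C_k = {pi <= tau_k}, then pi recognises the last record only on the disjoint
   events (C_k \ C_{k-1}) /\ L_k, and the sum of their probabilities telescopes
   into the sum of the D_k(C_k), up to a term that vanishes in the limit.  The
   same computation with B_k for C_k gives the threshold policy, because the
   scaled remaining time decreases along the path. *)

Require Import Defs.
From mathcomp Require Import all_boot all_order all_algebra finmap.
From mathcomp Require Import all_classical all_reals all_analysis.
From mathcomp Require Import measurable_realfun ring lra.

Import Order.TTheory GRing.Theory Num.Theory.
Import numFieldNormedType.Exports.
Local Open Scope classical_set_scope.
Local Open Scope ring_scope.

Set Implicit Arguments.
Unset Strict Implicit.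
Unset Printing Implicit Defensive.

(** * Exponential integrals *)

(** The comparison is discrete, while policies are adapted to a right-continuous filtration in
    continuous time. The main obstacle is therefore to show that C_k is known from the first k
    factors and clocks; it is overcome because the path, as long as tau_{k+1} has not occurred, is a
    function of those draws. Conditioning at tau_k then needs no conditional expectations: the next
    draws X_k, E_k, E_{k+1} are independent of that past, so they can be integrated out for each
    fixed value of the scaled time.

    The weights come from reading the clocks in scaled time: a sojourn uses up E_k, and the jump
    multiplies what is left by X_k. No record follows when E_k > s; exactly one follows when u = E_k
    < s and E_{k+1} > (s - u) X_k. For X_k = x the latter has probability the integral of exp(-u)
    exp(-(s - u) x) over [0, s], which is exp(-s) (exp(s(1 - x)) - 1) / (1 - x).

    The description by draws holds only almost surely, so everything is restricted to one measurable
    event of probability 1, which is counted as part of every past. *)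

Section exponential.
Context {R : realType}.
Implicit Types (m : probability R R) (s x y : R).

Local Notation lambda := (@lebesgue_measure R).

Lemma is_derive_expRM (c x : R) :
  is_derive x 1 (fun u => expR (c * u)) (c * expR (c * x)).
Proof.
have dM : is_derive x 1 (fun u : R => c * u) c.
  by apply: is_derive_eq; rewrite /GRing.scale/= mulr1.
have := @is_derive1_comp R expR (fun u => c * u) x _ _ _ dM.
by move=> /(_ _ (is_derive_expR _)); rewrite mulrC.
Qed.

Lemma exponential_tail y : 0 <= y ->
  exponential_prob 1 `]y, +oo[ = (expR (- y))%:E.
Proof.
move=> y0; have cexp : continuous (fun z : R => - expR (- 1 * z)).
  move=> z; apply: cvgN; apply: continuous_comp; last exact: continuous_expR.
  by apply: continuousM => //; exact: cst_continuous.
rewrite /exponential_prob integral_itv_obnd_cbnd; last first.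
  apply/measurable_EFinP/measurable_funTS; exact: measurable_exponential_pdf.
rewrite (@ge0_continuous_FTC2y _ _ (fun x => - expR (- 1 * x)) _ 0)//.
- by rewrite mulN1r EFinN oppeK add0e.
- by move=> x _; apply: exponential_pdf_ge0.
- apply: (@continuous_subspaceW R^o _ _ [set` `[0, +oo[%R]).
    by apply: subset_itvr; rewrite bnd_simp.
  exact: within_continuous_exponential_pdf.
- rewrite -oppr0; apply: cvgN.
  under eq_fun do rewrite mulN1r.
  exact: cvgr_expR.
- by apply: cvg_at_right_filter; exact: cexp.
- move=> x; rewrite in_itv/= andbT => yx.
  by apply: derive1_exponential_pdf; rewrite in_itv/= andbT (le_lt_trans y0).
Qed.

Lemma exponential_prob_dominates : exponential_prob 1 `<< lambda.
Proof.
apply/null_content_dominatesP => A mA A0.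
rewrite /exponential_prob null_set_integral//.
apply/measurable_funTS/measurableT_comp => //.
exact: measurable_exponential_pdf.
Qed.

(** The density is almost everywhere the Radon-Nikodym derivative of the exponential law, since both
    have the same integral over every measurable set. The bound on [f] makes it integrable, as the
    change of variables requires. *)
Lemma exponential_finite_integral m (f : R -> \bar R) :
    (forall A, measurable A -> m A = exponential_prob 1 A) ->
    measurable_fun setT f -> (forall u, 0 <= f u <= 1)%E ->
  (\int[m]_u f u = \int[lambda]_u (f u * (exponential_pdf 1 u)%:E))%E.
Proof.
move=> mE mf f01.
pose nu : probability (measurableTypeR R) R :=
  exponential_distribution_exponential_prob__canonical__probability_measure_Probability
    (@ltr01 R).
have nuE A : nu A = exponential_prob 1 A by [].
have nulambda : nu `<< lambda by exact: exponential_prob_dominates.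
(* The real line occurs here as two measurable types with the same measurable sets; pushing forward
   along the identity passes from one to the other. *)
pose idR : measurableTypeR R -> R := idfun.
have midR : measurable_fun setT idR by move=> _ A mA; rewrite setTI; exact: mA.
have -> : (\int[m]_u f u = \int[nu]_u f u)%E.
  rewrite -[RHS](@ge0_integral_pushforward _ _ _ _ R idR midR nu setT f)//; last first.
    by move=> u _; have /andP[] := f01 u.
  apply: eq_measure_integral => A mA _.
  exact: mE.
rewrite -(@Radon_Nikodym_change_of_variables _ _ _ nu lambda nulambda)//=; last first.
  apply/integrableP; split => //.
  apply: (@le_lt_trans _ _ (\int[nu]_x cst 1%E x)%E).
    apply: ge0_le_integral => //=; first exact: measurableT_comp.
    by move=> u _; have /andP[f0 f1] := f01 u; rewrite gee0_abs.
  rewrite integral_cst// mul1e; apply: (@le_lt_trans _ _ 1%E); last exact: ltry.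
  exact: (@probability_le1 _ _ _ nu).
apply: ae_eq_integral => //.
- by apply: emeasurable_funM.
- apply: emeasurable_funM => //=; apply/measurableT_comp => //=.
  exact: measurable_exponential_pdf.
- apply: ae_eqe_mul2l => /=.
  rewrite Radon_NikodymE//=.
  case: cid => /= h [h1 h2 h3].
  apply: integral_ae_eq => //=.
  + by apply/measurableT_comp =>//; exact: measurable_exponential_pdf.
  + by move=> E _ mE'; rewrite -h3.
Qed.

(** The first clock rings at [u], leaving the scaled time [(s - u) * x], during which the second
    clock must stay silent. *)
Lemma overshoot_integral s x : 0 < s -> 0 < x < 1 ->
  (\int[lambda]_(u in `[0%R, s]) (expR (- ((s - u) * x)) * expR (- u))%:E)%E =
  (expR (- s) * ((expR (s * (1 - x)) - 1) / (1 - x)))%:E.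
Proof.
move=> s0 /andP[x0 x1].
(* An antiderivative, read off after rewriting the integrand as exp(-sx) exp(-(1 - x)u). *)
pose F (u : R) : R := - (expR (- (s * x)) / (1 - x)) * expR (- (1 - x) * u).
have x10 : 1 - x != 0 by lra.
have cF (c : R) : continuous (fun u => expR (c * u)).
  move=> z; apply: continuous_comp; last exact: continuous_expR.
  by apply: continuousM => //; exact: cst_continuous.
have dF (u : R) : is_derive u 1 F (expR (- (s * x)) * expR (- (1 - x) * u)).
  have := is_deriveZ (- (expR (- (s * x)) / (1 - x))) (is_derive_expRM (- (1 - x)) u).
  by move=> dFu; apply: (is_derive_eq dFu); rewrite /GRing.scale/=; field.
rewrite (eq_integral (fun u : measurableTypeR R =>
  (expR (- (s * x)) * expR (- (1 - x) * u))%:E)); last first.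
  by move=> u _; congr EFin; rewrite -!expRD; congr expR; ring.
rewrite (@continuous_FTC2 _ _ F)//.
- rewrite -EFinB; congr EFin; rewrite /F mulr0 expR0.
  rewrite (_ : - (1 - x) * s = - s + s * x) ?expRD; last by ring.
  rewrite (_ : s * (1 - x) = s - s * x) ?expRD; last by ring.
  rewrite !expRN; field.
  by rewrite ?x10 ?expR_eq0.
- apply: continuous_subspaceT => u.
  by apply: cvgM; [exact: cvg_cst|exact: cF].
- have cFF : continuous F.
    by move=> u; apply: cvgM; [exact: cvg_cst|exact: cF].
  split.
  + by move=> u _; exact: ex_derive.
  + exact/cvg_at_right_filter/cFF.
  + exact/cvg_at_left_filter/cFF.
- by move=> u _; rewrite derive1E; apply: derive_val.
Qed.
End exponential.

(** * The threshold *)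

Section inverse.
Context {R : realType}.

(** Inversion is continuous on the open complement of 0, and any function is measurable on the
    singleton that remains. *)
Lemma measurable_invr : measurable_fun setT (@GRing.inv R).
Proof.
rewrite -(setvU [set 0 : R]); apply/measurable_funU => //.
  exact: measurableC.
split; last exact: measurable_fun_set1.
apply: open_continuous_measurable_fun.
  by rewrite openC; exact: closed_eq.
by move=> x; rewrite inE/= => /eqP x0; exact: inv_continuous.
Qed.

End inverse.

Section measurable_comparisons.
Context d (T : measurableType d) (R : realType).
Implicit Types f g : T -> R.

Lemma measurable_ltr_set f g : measurable_fun setT f -> measurable_fun setT g ->
  measurable [set w | f w < g w].
Proof.
move=> mf mg; have := measurable_fun_ltr mf mg.
by move=> /(_ measurableT [set true]); rewrite setTI; apply.
Qed.

Lemma measurable_ler_set f g : measurable_fun setT f -> measurable_fun setT g ->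
  measurable [set w | f w <= g w].
Proof.
move=> mf mg; have := measurable_fun_ler mf mg.
by move=> /(_ measurableT [set true]); rewrite setTI; apply.
Qed.

End measurable_comparisons.

Section threshold.
Context {R : realType}.
Implicit Types (m mX : probability R R) (s x y : R).

(** For x different from 1 this is the integral of exp(u(1 - x)) over u from 0 to s. At x = 1 the
    inverse of 0 is 0, so the value is 0 and not the limit s. *)
Definition phi s x : R := (expR (s * (1 - x)) - 1) / (1 - x).

Lemma measurable_phi s : measurable_fun setT (phi s).
Proof.
apply: measurable_funM.
  apply: measurable_funB => //; apply: measurableT_comp => //.
  apply: measurable_funM => //; exact: measurable_funB.
apply: (measurableT_comp measurable_invr); exact: measurable_funB.
Qed.

(** Numerator and denominator have the same sign. Covering every real [x] allows integration over
    the whole line before restricting to ]0, 1[. *)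
Lemma phi_ge0 s x : 0 <= s -> 0 <= phi s x.
Proof.
move=> s0; rewrite /phi; have [x1|x1|->] := ltgtP x 1.
- apply: divr_ge0; last by rewrite subr_ge0 ltW.
  by rewrite subr_ge0 -[leLHS]expR0 ler_expR mulr_ge0// subr_ge0 ltW.
- apply: mulr_le0; last by rewrite invr_le0 subr_le0 ltW.
  by rewrite subr_le0 -[leRHS]expR0 ler_expR mulr_ge0_le0// subr_le0 ltW.
- by rewrite subrr invr0 mulr0.
Qed.

(** The derivative in s is exp(s(1 - x)), which lies between 1 and exp(t). Both bounds are free of
    [x], so they survive integration: the lower one gives strict growth, the upper one
    continuity. *)
Lemma phi_increment s t x : 0 <= s -> s <= t -> 0 < x < 1 ->
  t - s <= phi t x - phi s x <= (t - s) * expR t.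
Proof.
move=> s0 st /andP[x0 x1].
have y0 : 0 < 1 - x by lra.
pose d := expR ((t - s) * (1 - x)).
have -> : phi t x - phi s x = expR (s * (1 - x)) * (d - 1) / (1 - x).
  rewrite /phi -mulrBl; congr (_ / _).
  have -> : t * (1 - x) = s * (1 - x) + (t - s) * (1 - x) by ring.
  by rewrite expRD /d; ring.
have d1 : (t - s) * (1 - x) <= d - 1 by rewrite lerBrDl expR_ge1Dx.
have ts0 : 0 <= (t - s) * (1 - x) by rewrite mulr_ge0 ?subr_ge0// ltW.
have e1 : 1 <= expR (s * (1 - x)).
  by rewrite -[leLHS]expR0 ler_expR mulr_ge0// ltW.
apply/andP; split.
  rewrite ler_pdivlMr//; apply: (le_trans d1).
  by rewrite ler_peMl// (le_trans ts0).
rewrite ler_pdivrMr//.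
(* This is 1 - y <= exp(-y) multiplied by exp(y), with y = (t - s)(1 - x). *)
have dd : d - 1 <= (t - s) * (1 - x) * d.
  have := expR_ge1Dx (- ((t - s) * (1 - x))).
  rewrite expRN -/d -(ler_pM2r (expR_gt0 ((t - s) * (1 - x)))) -/d mulVf ?expR_eq0//.
  lra.
apply: (le_trans (ler_wpM2l _ dd)); first by rewrite expR_ge0.
rewrite [leLHS](_ : _ = (t - s) * ((1 - x) * expR (t * (1 - x)))); last first.
  rewrite /d (_ : t * (1 - x) = s * (1 - x) + (t - s) * (1 - x)); last by ring.
  by rewrite expRD; ring.
rewrite -mulrA ler_wpM2l ?subr_ge0// mulrC ler_wpM2r ?(ltW y0)//.
by rewrite ler_expR; nra.
Qed.

Lemma phi0 x : phi 0 x = 0.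
Proof. by rewrite /phi mul0r expR0 subrr mul0r. Qed.

Lemma phi_expR_ge s x : 0 <= s -> 0 < x < 1 -> phi s x <= s * expR s.
Proof.
by move=> s0 x01; have /andP[_] := phi_increment (lexx 0) s0 x01; rewrite phi0 !subr0.
Qed.

(** By Fubini in the first clock [u]: for [u] in [0, s[ the section is a half-line of mass exp(-(s -
    u)x); negative [u] have density 0, and for [u] at least [s] the section is empty. *)
Lemma overshoot_prob m s x :
    (forall A, measurable A -> m A = exponential_prob 1 A) ->
    0 < s -> 0 < x < 1 ->
  (m \x m)%E [set p : R * R | p.1 < s /\ (s - p.1) * x < p.2] = (expR (- s) * phi s x)%:E.
Proof.
move=> mE s0 /[dup] x01 /andP[x0 x1].
set K := [set p : R * R | _].
have mK : measurable K.
  apply: measurableI; first exact: measurable_ltr_set.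
  apply: measurable_ltr_set => //; apply: measurable_funM => //.
  exact: measurable_funB.
rewrite /product_measure1/= (exponential_finite_integral mE); last 2 first.
- exact: measurable_fun_xsection.
- by move=> u; rewrite measure_ge0 probability_le1//; exact: measurable_xsection.
rewrite /phi -overshoot_integral// -[in RHS]integral_itv_bndo_bndc; last first.
  apply/measurable_EFinP/measurable_funTS/measurable_funM.
    apply: measurableT_comp => //; apply: measurable_funN.
    apply: measurable_funM => //; exact: measurable_funB.
  by apply: measurableT_comp => //; exact: oppr_measurable.
rewrite [RHS]integral_mkcond/=; apply: eq_integral => u _; rewrite patchE.
case: ifPn => [|]; rewrite ?notin_setE ?inE/= in_itv/=.
  move=> /andP[u0 us].
  rewrite exponential_pdfE//= mul1r mulN1r EFinM; congr (_ * _)%E.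
  rewrite -exponential_tail; last by rewrite mulr_ge0 ?subr_ge0 ?(ltW us)// ltW.
  rewrite -mE//; congr (m _); apply/seteqP; split => y; rewrite /xsection/= inE/= in_itv/= andbT.
    by case.
  by [].
move=> /negP; rewrite negb_and -!ltNge.
have [u0|u0] := ltP u 0; first by rewrite lt0_exponential_pdf// mule0.
rewrite /= -leNgt => su.
rewrite (_ : xsection K u = set0) ?measure0 ?mul0e//.
by apply/seteqP; split => y //; rewrite /xsection/= inE/= => -[]/=; rewrite ltNge su.
Qed.

End threshold.

Section Phi.
Context {R : realType} (mX : probability R R).
Hypothesis mX01 : mX `]0, 1[%classic = 1%E.
Implicit Types s t x : R.

Lemma unit_interval_integral (f : R -> \bar R) :
    measurable_fun setT f -> (forall x, 0 <= f x)%E ->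
  (\int[mX]_x f x = \int[mX]_(x in `]0%R, 1%R[) f x)%E.
Proof.
move=> mf f0.
rewrite (@ge0_negligible_integral _ _ _ mX setT (~` `]0, 1[%classic))//; last 2 first.
- exact: measurableC.
- by move: (probability_setC mX (measurable_itv `]0, 1[)); rewrite mX01 subee.
by rewrite setDE setCK setTI.
Qed.

Lemma integrable_phi s : 0 <= s -> mX.-integrable `]0, 1[%classic (EFin \o phi s).
Proof.
move=> s0; apply: measurable_bounded_integrable => //.
- by apply: (le_lt_trans (probability_le1 mX _)) => //; exact: ltry.
- by apply: measurable_funTS; exact: measurable_phi.
exists (s * expR s); split; first exact: num_real.
move=> M sM x /=; rewrite in_itv/= => x01.
by rewrite ger0_norm ?phi_ge0// (le_trans (phi_expR_ge _ x01))// ltW.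
Qed.

(** On ]0, 1[ the integrand is bounded for nonnegative [s], so this real-valued integral is a
    genuine one and not a default value. *)
Definition Phi s : R := (\int[mX]_(x in `]0, 1[) phi s x)%R.

Lemma integral_phi s : 0 <= s -> (\int[mX]_x (phi s x)%:E = (Phi s)%:E)%E.
Proof.
move=> s0; rewrite unit_interval_integral; last 2 first.
- by apply/measurable_EFinP; exact: measurable_phi.
- by move=> x; rewrite lee_fin phi_ge0.
by rewrite /Phi /Rintegral fineK//; exact: integrable_fin_num (integrable_phi s0).
Qed.

Lemma Phi0 : Phi 0 = 0.
Proof.
rewrite /Phi (@eq_Rintegral _ _ _ _ _ (cst 0)) ?Rintegral_cst ?mul0r//.
by move=> x _; rewrite phi0.
Qed.

Lemma Phi_increment s t : 0 <= s -> s <= t ->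
  t - s <= Phi t - Phi s <= (t - s) * expR t.
Proof.
move=> s0 st.
have [is_ it] := (integrable_phi s0, integrable_phi (le_trans s0 st)).
rewrite -RintegralB//.
have cE c : c = (\int[mX]_(x in `]0, 1[) c)%R.
  rewrite (_ : (fun=> c) = cst c)// Rintegral_cst//.
  by rewrite (_ : fine _ = 1) ?mulr1//; exact: (congr1 fine mX01).
have ic c : mX.-integrable `]0, 1[%classic (EFin \o cst c).
  by apply/finite_measure_integrable_cst.
have iB : mX.-integrable `]0, 1[%classic (EFin \o (fun x => phi t x - phi s x)).
  exact: (integrableB (measurable_itv _) it is_).
apply/andP; split; [rewrite [leLHS]cE|rewrite [leRHS]cE];
  apply: le_Rintegral => //; try exact: ic.
- by move=> x /=; rewrite in_itv/= => x01; have /andP[] := phi_increment s0 st x01.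
- by move=> x /=; rewrite in_itv/= => x01; have /andP[] := phi_increment s0 st x01.
Qed.

Lemma Phi_le s t : 0 <= s -> s <= t -> Phi s <= Phi t.
Proof. 
move=> s0 st; have /andP[+ _] := Phi_increment s0 st.
by move=> h; rewrite -subr_ge0 (le_trans _ h)// subr_ge0.
 Qed.

(** The increment bounds give Phi 1 >= 1 and the Lipschitz constant exp(1) on [0, 1], so the value 1
    is taken between 0 and 1. Increments of at least t - s make the solution unique on the whole
    half-line. *)
Lemma threshold_exists_unique : exists! s, 0 < s /\ Phi s = 1.
Proof.
have cPhi : {within `[0, 1], continuous Phi}.
  apply/continuous_within_itvP; first exact: ltr01.
  have lip s t : 0 <= s <= 1 -> 0 <= t <= 1 -> `|Phi s - Phi t| <= `|s - t| * expR 1.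
    wlog ts : s t / t <= s.
      move=> H s01 t01; have [ts|st] := leP t s; first exact: H.
      by rewrite distrC (distrC s); apply: H => //; exact: ltW.
    move=> /andP[s0 s1] /andP[t0 t1].
    have /andP[l u] := Phi_increment t0 ts.
    rewrite ger0_norm ?(le_trans _ l) ?subr_ge0// ger0_norm ?subr_ge0//.
    by rewrite (le_trans u)// ler_wpM2l ?subr_ge0// ler_expR.
  (* An arbitrary filter covers at once the two-sided limits inside and the one-sided limits at both
     ends. *)
  have lim (F : set_system R) (FF : Filter F) (a : R) : 0 <= a <= 1 ->
      F --> a -> (\forall x \near F, 0 <= x <= 1) -> Phi @ F --> Phi a.
    move=> a01 Fa F01; apply/cvgrPdist_le => e e0.
    near=> x; apply: (le_trans (lip _ _ a01 _)); first by near: x.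
    rewrite -ler_pdivlMr ?expR_gt0//; near: x.
    by move/cvgrPdist_le: Fa; apply; rewrite divr_gt0 ?expR_gt0.
  split.
  - move=> x; rewrite in_itv/= => /andP[x0 x1].
    apply: lim => //; first by rewrite !ltW.
    near=> y; apply/andP; split; apply: ltW; near: y.
      exact: lt_nbhsr.
    exact: lt_nbhsl.
  - apply: lim; first by rewrite lexx ler01.
      exact: cvg_at_right_filter.
    near=> y; apply/andP; split; near: y; first exact: nbhs_right_ge.
    exact: nbhs_right_le.
  - apply: lim; first by rewrite lexx ler01.
      exact: cvg_at_left_filter.
    near=> y; apply/andP; split; near: y; first exact: nbhs_left_ge.
    exact: nbhs_left_le.
have [||s] := @IVT R Phi 0 1 1 _ cPhi; rewrite ?ler01// ?Phi0.
  have := Phi_increment (lexx 0) ler01; rewrite Phi0 => ?.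
  by rewrite ge_min le_max ler01/=; lra.
rewrite in_itv/= => /andP[s0 s1] Ps; exists s; split.
  split=> //; rewrite lt_neqAle s0 andbT; apply/eqP => s0'.
  by move: Ps; rewrite -s0' Phi0 => /eqP; rewrite eq_sym oner_eq0.
move=> t [t0 Pt]; have [st|ts] := leP s t.
  have /andP[+ _] := Phi_increment s0 st.
  by rewrite Pt Ps subrr subr_le0 => ts; apply/eqP; rewrite eq_le st.
have /andP[+ _] := Phi_increment (ltW t0) (ltW ts).
by rewrite Pt Ps subrr subr_le0 leNgt ts.
Unshelve. all: by end_near. Qed.

Section product.
Variable m : probability R R.
Hypothesis mE : forall A, measurable A -> m A = exponential_prob 1 A.

(* With scaled remaining time [s] and next draws [z = (x, (e, e'))], [quiet s]
   says that no record follows and [single s] that exactly one does. *)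
Definition quiet s : set (R * (R * R)) := [set z | s < z.2.1].

Definition single s : set (R * (R * R)) :=
  [set z | z.2.1 < s /\ (s - z.2.1) * z.1 < z.2.2].

Definition clocks : probability (R * R)%type R := (m \x m)%E.

Definition future : probability (R * (R * R))%type R := (mX \x clocks)%E.

Lemma clocks_rect A B : measurable A -> measurable B ->
  clocks (A `*` B) = (m A * m B)%E.
Proof. exact: product_measure1E. Qed.

Lemma future_rect A B : measurable A -> measurable B ->
  future (A `*` B) = (mX A * clocks B)%E.
Proof. exact: product_measure1E. Qed.

Lemma quiet_prob s : 0 <= s -> future (quiet s) = (expR (- s))%:E.
Proof.
move=> s0.
have -> : quiet s = setT `*` (`]s, +oo[%classic `*` setT).
  apply/seteqP; split => z; rewrite /quiet/= ?in_itv/= ?andbT//.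
  by case=> _ [].
have mI : measurable (`]s, +oo[ `*` [set: R]) by exact: measurableX.
rewrite future_rect// clocks_rect// !probability_setT mul1e mule1 -(exponential_tail s0).
exact: mE.
Qed.

Let mfst2 : measurable_fun setT (fun z : R * (R * R) => z.2.1).
Proof. exact: (measurableT_comp measurable_fst measurable_snd). Qed.

Let msnd2 : measurable_fun setT (fun z : R * (R * R) => z.2.2).
Proof. exact: (measurableT_comp measurable_snd measurable_snd). Qed.

Lemma single_prob s : 0 < s -> future (single s) = (expR (- s) * Phi s)%:E.
Proof.
move=> s0.
have -> : future (single s) =
  (\int[mX]_x clocks (xsection (single s) x))%E by [].
have mS : measurable (single s).
  apply: measurableI; apply: measurable_ltr_set => //.
  by apply: measurable_funM => //; exact: measurable_funB.
rewrite unit_interval_integral; last 2 first.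
- exact: measurable_fun_xsection.
- by [].
transitivity (\int[mX]_(x in `]0%R, 1%R[) ((expR (- s))%:E * (phi s x)%:E))%E.
  apply: eq_integral => x; rewrite inE/= in_itv/= => x01.
  rewrite -EFinM -(overshoot_prob mE s0 x01); congr (_ _).
  by apply/seteqP; split => p; rewrite /xsection/= inE.
rewrite ge0_integralZl_EFin//; last 2 first.
- by move=> x _; rewrite lee_fin phi_ge0// ltW.
- by apply/measurable_EFinP; apply: measurable_funTS; exact: measurable_phi.
rewrite -unit_interval_integral ?integral_phi ?EFinM// ?ltW//.
- by apply/measurable_EFinP; exact: measurable_phi.
- by move=> x; rewrite lee_fin phi_ge0// ltW.
Qed.
End product.
End Phi.

(** * Paths of jump processes *)

Section jump_paths.
Context {R : realType}.
Implicit Types (f : R -> R) (s t : R).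

Lemma jump_path_right f t : jump_path f -> 0 <= t ->
  exists2 b, t < b & forall s, t <= s < b -> f s = f t.
Proof.
move=> [u [u0 undec uoo fu]] t0.
have ex : exists n, t < u n.
  have /cvgryPgt/(_ t)[n _ /(_ n (leqnn n)) tn] := uoo.
  by exists n.
have := ex_minnP ex; case: ex_minnP => -[|n] tn nmin _; first by rewrite u0 ltNge t0 in tn.
have unt : u n <= t by rewrite leNgt; apply/negP => /nmin; rewrite ltnn.
exists (u n.+1) => // s /andP[ts su].
by rewrite (fu n s) ?(fu n t) ?unt ?su ?(le_trans unt).
Qed.

Lemma jump_path_left f t : jump_path f -> 0 < t ->
  exists2 a, 0 <= a < t & forall s, a <= s < t -> f s = f a.
Proof.
move=> [u [u0 undec uoo fu]] t0.
have ex : exists n, t <= u n.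
  have /cvgryPge/(_ t)[n _ /(_ n (leqnn n)) tn] := uoo.
  by exists n.
have := ex_minnP ex; case: ex_minnP => -[|n] tn nmin _; first by rewrite u0 leNgt t0 in tn.
have unt : u n < t by rewrite ltNge; apply/negP => /nmin; rewrite ltnn.
exists (u n); first by rewrite unt -u0 undec.
by move=> s /andP[us st]; rewrite (fu n s)// us (lt_le_trans st).
Qed.

Lemma left_limit_const f c a t : a < t -> (forall s, a < s < t -> f s = c) ->
  left_limit f t = c.
Proof.
move=> at_ fc; apply: cvg_lim => //; apply: cvg_near_cst.
near=> s; apply: fc; apply/andP; split; near: s.
  exact: nbhs_left_gt.
exact: nbhs_left_lt.
Unshelve. all: by end_near. Qed.

Section nonincreasing.
Variable f : R -> R.
Hypothesis fjump : jump_path f.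
Hypothesis fnoninc : forall s t, 0 <= s -> s <= t -> f t <= f s.

(** The path is constant on some [a, t[, so the left limit is [f a]; by monotonicity, being below
    [f a] is being below every earlier value. *)
Lemma is_recordP t : is_record f t <-> 0 < t /\ forall s, 0 <= s < t -> f t < f s.
Proof.
split=> -[t0 ft]; split=> //; have [a /andP[a0 at_] fa] := jump_path_left fjump t0;
  have fta : left_limit f t = f a
    by apply: (left_limit_const at_) => s /andP[/ltW ? ?]; apply: fa; apply/andP.
- rewrite fta in ft.
  move=> s /andP[s0 st]; have [as_|sa] := leP a s; first by rewrite (fa s)// as_.
  by rewrite (lt_le_trans ft)// fnoninc// ltW.
- by rewrite /is_record fta; apply: ft; rewrite a0.
Qed.

(** The point [r] is the infimum of the times up to [t] at which the path already has the value
    [f t]; constancy just to the right of [r] shows that it is attained. *)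
Lemma last_change t : 0 <= t -> exists2 r, 0 <= r <= t &
  (forall s, r <= s <= t -> f s = f t) /\ (forall s, 0 <= s < r -> f t < f s).
Proof.
move=> t0; pose A := [set s | 0 <= s <= t /\ f s = f t].
have At : A t by rewrite /A/= t0 lexx.
have A0 : lbound A 0 by move=> s [/andP[]].
have iA : has_inf A by split; [exists t|exists 0].
pose r := inf A.
have r0 : 0 <= r by apply: lb_le_inf => //; exists t.
have rt : r <= t by apply: ge_inf => //; exists 0.
have [b rb fb] := jump_path_right fjump r0.
have frt : f r = f t.
  have br : 0 < b - r by rewrite subr_gt0.
  have [s As] := inf_adherent br iA; rewrite subrKC => sb.
  rewrite -(fb s) ?As.2// sb andbT.
  by apply: ge_inf As; exists 0.
exists r; first by rewrite r0.
split=> s /andP[h1 h2].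
  apply/eqP; rewrite eq_le -{1}frt !fnoninc//.
  exact: le_trans h1.
rewrite lt_neqAle fnoninc ?andbT 1?eq_sym// ?(le_trans (ltW h2))//.
apply/eqP => fs; have := h2; rewrite ltNge => /negP; apply.
by apply: ge_inf; [exists 0|split=> //; rewrite h1 (le_trans (ltW h2))].
Qed.

(** Success means stopping exactly when the path reaches its final value [f T]. A rational strictly
    between [p] and that time would violate one of the two implications, so countably many
    conditions suffice; this is what makes the success event measurable. *)
Lemma recognisesP (T : R) (p : \bar R) : 0 < T ->
  (exists t : R, [/\ p = t%:E, is_record f t, f t = f T & t < T]) <->
  ((0 < p < T%:E)%E /\ forall q : rat, 0 <= (ratr q : R) <= T ->
    (((ratr q)%:E < p)%E -> f (ratr q) <> f T) /\
    ((p < (ratr q)%:E)%E -> f (ratr q) = f T)).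
Proof.
move=> T0; split.
  move=> [t [-> /is_recordP[t0 ft] ftT tT]]; rewrite !lte_fin t0; split=> // q /andP[q0 qT].
  rewrite !lte_fin; split.
    by move=> qt; apply/eqP; rewrite gt_eqF// -ftT ft// q0.
  move=> tq; apply/eqP; rewrite eq_le -{1}ftT !fnoninc// ?(ltW tq)//.
  exact: ltW.
case=> /andP[p0 pT]; case: p p0 pT => [t| |]; last 2 first.
- by move=> _; rewrite ltNge leey.
- by rewrite ltNge leNye.
rewrite !lte_fin => t0 tT H; exists t.
have [r /andP[r0 rT] [fr1 fr2]] := last_change (ltW T0).
have tr : t = r.
  apply/eqP; rewrite eq_le !leNgt; apply/andP; split; apply/negP => /rat_in_itvoo[q].
    rewrite in_itv/= => /andP[rq qt].
    have [|+ _] := H q; first by rewrite (le_trans r0) ?(ltW rq)//= ltW// (lt_trans qt).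
    by rewrite lte_fin => /(_ qt); apply; rewrite fr1// (ltW rq) ltW// (lt_trans qt).
  rewrite in_itv/= => /andP[tq qr].
  have [|_ +] := H q; first by rewrite (le_trans (ltW t0)) ?(ltW tq)//= (le_trans (ltW qr)).
  rewrite lte_fin => /(_ tq) fq.
  have : f T < f (ratr q) by apply: fr2; rewrite qr andbT ltW// (lt_trans t0).
  by rewrite fq ltxx.
split=> //; last by rewrite tr fr1// lexx -tr ltW.
apply/is_recordP; split=> // s; rewrite tr => sr.
by rewrite (fr1 r) ?fr2// lexx -tr ltW.
Qed.


(** The path is constant on some [t, b[, so a record after [t] comes no earlier than [b], and the
    infimum cannot equal [t] without being attained. *)
Lemma first_record_leP (S : set R) (t : R) : 0 <= t -> (forall u, S u -> is_record f u) ->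
  (ereal_inf [set u%:E | u in S] <= t%:E)%E <-> exists2 u, S u & u <= t.
Proof.
move=> t0 Srec; split=> [inft|[u Su ut]]; last first.
  by apply: (@le_trans _ _ u%:E); [apply: ereal_inf_lbound; exists u|rewrite lee_fin].
have [b tb fb] := jump_path_right fjump t0.
apply: contrapT => nS.
suff : (b%:E <= ereal_inf [set u%:E | u in S])%E.
  by move=> /le_trans/(_ inft); rewrite lee_fin leNgt tb.
apply: le_ereal_inf_tmp => _ [u Su <-]; rewrite lee_fin leNgt; apply/negP => ub.
have tu : t < u by rewrite ltNge; apply/negP => ut; apply: nS; exists u.
have /is_recordP[u0 /(_ t)] := Srec _ Su.
by rewrite t0 tu => /(_ isT); rewrite (fb u) ?ltxx// ub ltW.
Qed.

(** If some record up to [t] lies in the region, so does the latest one, [r], because (T - u) f(u)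
    is nonincreasing before T. The three conditions say that [r] is a record and that (T - r) f(t)
    <= s, without naming [r]: the rationals approach [r] from the right, and the condition at [t]
    itself covers r = t, where there is no room for them. *)
Lemma record_in_regionP (T s t : R) : 0 <= t < T -> (forall u, 0 <= u -> 0 < f u) ->
  (exists2 u, [/\ is_record f u, u < T & (T - u) * f u <= s] & u <= t) <->
  [/\ f 0 <> f t, (T - t) * f t <= s &
      forall q : rat, 0 <= (ratr q : R) <= t -> s < (T - ratr q) * f t ->
        f (ratr q) <> f t].
Proof.
move=> /andP[t0 tT] f0; split.
  move=> [u [/is_recordP[u0 fu] uT us] ut].
  have ftu : f t <= f u by rewrite fnoninc// ltW.
  have le_s q : u <= q -> q <= t -> (T - q) * f t <= s.
    move=> uq qt; apply: le_trans us; apply: ler_pM => //.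
    - by rewrite subr_ge0 (le_trans qt)// ltW.
    - by rewrite ltW// f0.
    - by rewrite lerB.
  split.
  - by apply/eqP; rewrite gt_eqF// (le_lt_trans ftu)// fu// lexx.
  - exact: le_s.
  - move=> q /andP[q0 qt] sq; apply/eqP; rewrite gt_eqF// (le_lt_trans ftu)// fu// q0/=.
    by rewrite ltNge; apply/negP => uq; move: sq; rewrite ltNge le_s.
move=> [f0t st H]; have [r /andP[r0 rt] [fr1 fr2]] := last_change t0.
have frt : f r = f t by rewrite fr1// lexx.
have r_gt0 : 0 < r.
  by rewrite lt_neqAle r0 andbT; apply/eqP => r0'; apply: f0t; rewrite fr1// -r0' lexx.
exists r => //; split.
- by apply/is_recordP; split=> // u ur; rewrite frt fr2.
- exact: le_lt_trans tT.
rewrite frt; have [tr|rltt] := leP t r; first by rewrite (_ : r = t)//; apply/eqP; rewrite eq_le rt.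
rewrite leNgt; apply/negP => sr.
have ft0 := f0 _ t0.
(* Times before [T - s / f t] are those at which the value [f t] would still be outside the
   region. *)
have : r < Num.min t (T - s / f t).
  by rewrite lt_min rltt/= ltrBrDl -ltrBrDr ltr_pdivrMr.
move=> /rat_in_itvoo[q]; rewrite in_itv/= lt_min => /and3P[rq qt qs].
apply: (H q); first by rewrite (le_trans r0) ?(ltW rq)//= ltW.
- by rewrite -ltr_pdivrMr// ltrBrDl -ltrBrDr.
- by rewrite fr1// !ltW.
Qed.

End nonincreasing.
End jump_paths.

(** * Policies *)

(** The levels q - q/(n + 1) never become negative, as is needed because stopping times are only
    tested at nonnegative times. *)
Lemma lt_approxP (R : realType) (p : \bar R) (q : R) : (0 <= p)%E -> 0 < q ->
  (p < q%:E)%E <-> exists n : nat, (p <= (q - q / n.+1%:R)%:E)%E.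
Proof.
move=> p0 q0; split; last first.
  by move=> [n /le_lt_trans]; apply; rewrite lte_fin ltrBlDr ltrDl divr_gt0.
case: p p0 => [x| |]//; rewrite lee_fin lte_fin => x0 xq.
exists (Num.trunc ((q - x)^-1 * q)); rewrite lee_fin lerBrDl -lerBrDr.
by rewrite ltW// ltr_pdivrMr// -ltr_pdivrMl ?subr_gt0// truncnS_gt.
Qed.

Section measurable_predicates.
Context d (T : measurableType d).
Implicit Types A B : set T.

Lemma measurable_imply A B : measurable A -> measurable B ->
  measurable [set w | A w -> B w].
Proof.
move=> mA mB; rewrite (_ : [set _ | _] = ~` A `|` B).
  by apply: measurableU => //; exact: measurableC.
apply/seteqP; split => w /=; last by case.
by have [Aw /(_ Aw)|nAw _] := pselect (A w); [right|left].
Qed.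

Lemma measurable_imply_cst (Q : Prop) A : (Q -> measurable A) ->
  measurable [set w | Q -> A w].
Proof.
move=> mA; have [q|nq] := pselect Q.
  by rewrite (_ : [set _ | _] = A); [exact: mA|apply/seteqP; split => w /=; tauto].
rewrite (_ : [set _ | _] = setT); first exact: measurableT.
by apply/seteqP; split => w /= _ // q.
Qed.

Lemma measurable_forall_rat (F : rat -> set T) : (forall q, measurable (F q)) ->
  measurable [set w | forall q, F q w].
Proof.
move=> mF; rewrite (_ : [set _ | _] = ~` \bigcup_q ~` F q).
  by apply/measurableC/bigcupT_measurable_rat => q; exact: measurableC.
rewrite setC_bigcup; apply/seteqP; split => w /= Fw q; first by move=> _; rewrite setCK.
by have := Fw q Logic.I; rewrite setCK.
Qed.

Lemma measurable_eqr_set (R : realType) (f g : T -> R) :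
  measurable_fun setT f -> measurable_fun setT g -> measurable [set w | f w = g w].
Proof.
move=> mf mg; rewrite (_ : [set _ | _] = [set w | f w <= g w] `&` [set w | g w <= f w]).
  by apply: measurableI; exact: measurable_ler_set.
by apply/seteqP; split => w /= => [->|[fg gf]]; [|apply/eqP; rewrite eq_le fg].
Qed.

End measurable_predicates.

Section filtration.
Context d (Omega : measurableType d) (R : realType) (Rp : R -> Omega -> R).
Hypothesis mRp : forall t, measurable_fun setT (Rp t).
Implicit Types (s t : R) (A : set Omega).

Let gens t := \bigcup_(u in `[0, t]) preimage_set_system setT (Rp u) measurable.

Lemma natural_filtrationS s t : s <= t ->
  natural_filtration Rp s `<=` natural_filtration Rp t.
Proof.
move=> st; apply: smallest_sub; first exact: smallest_sigma_algebra.
move=> A [u /=]; rewrite in_itv/= => /andP[u0 us] uA; apply: sub_sigma_algebra.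
by exists u => //=; rewrite in_itv/= u0 (le_trans us).
Qed.

Lemma natural_filtration_measurable t : natural_filtration Rp t `<=` measurable.
Proof.
apply: smallest_sub; first exact: sigma_algebra_measurable.
move=> A [u _ [B mB <-]]; exact: mRp.
Qed.

Lemma natural_filtration_right t : natural_filtration Rp t `<=` right_filtration Rp t.
Proof.
move=> A FA u /=; rewrite in_itv/= andbT => tu.
by apply: natural_filtrationS FA; exact: ltW.
Qed.

Lemma adapted u t : 0 <= u <= t ->
  measurable_fun setT (Rp u : g_sigma_algebraType (gens t) -> R).
Proof.
move=> u0t _ B mB; rewrite setTI; apply: sub_sigma_algebra.
exists u; first by rewrite /= in_itv.
by exists B => //; rewrite setTI.
Qed.

Variable pi : Omega -> \bar R.
Hypothesis spi : stopping_time Rp pi.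

(** Strictness removes the right limit: the event is a union of events pi <= t' with t' < t, and the
    right-continuous filtration at t' is contained in the natural one at t. *)
Lemma stopping_time_lt t : 0 < t -> natural_filtration Rp t [set w | (pi w < t%:E)%E].
Proof.
move=> t0; rewrite (_ : [set _ | _] =
  \bigcup_n [set w | (pi w <= (t - t / n.+1%:R)%:E)%E]); last first.
  apply/seteqP; split => w/=.
    by move=> /(lt_approxP (spi.1 w) t0)[n ?]; exists n.
  by move=> [n _ ?]; apply/(lt_approxP (spi.1 w) t0); exists n.
apply: (@bigcup_measurable _ (g_sigma_algebraType (gens t))) => n _.
have := spi.2 (t - t / n.+1%:R); apply.
  by rewrite subr_ge0 ler_pdivrMr// ler_peMr ?ler1n// ltW.
by rewrite /= in_itv/= andbT ltrBlDr ltrDl divr_gt0.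
Qed.

Lemma measurable_stopping_time_lt t : measurable [set w | (pi w < t%:E)%E].
Proof.
have [t0|t0] := ltP 0 t.
  by apply: natural_filtration_measurable; exact: stopping_time_lt.
rewrite (_ : [set _ | _] = set0)//; apply/seteqP; split => w //=.
by rewrite ltNge (le_trans _ (spi.1 w))// lee_fin.
Qed.

Lemma measurable_stopping_time_gt t : 0 <= t -> measurable [set w | (t%:E < pi w)%E].
Proof.
move=> t0; rewrite (_ : [set _ | _] = ~` [set w | (pi w <= t%:E)%E]); last first.
  by apply/seteqP; split => w /=; rewrite ltNge => /negP.
apply: measurableC; apply: (@natural_filtration_measurable (t + 1)).
by apply: spi.2 => //=; rewrite in_itv/= andbT ltrDl.
Qed.

End filtration.

Section step_process.
Context d (Omega : measurableType d) (R : realType) (Rp : R -> Omega -> R).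
Hypothesis mRp : forall t, measurable_fun setT (Rp t).
Hypothesis Rp_gt0 : forall w t, 0 <= t -> 0 < Rp t w.
Hypothesis Rp_noninc : forall w s t, 0 <= s -> s <= t -> Rp t w <= Rp s w.
Hypothesis Rp_jump : forall w, jump_path (Rp ^~ w).

(* [P] is only meaningful on measurable events, so this is needed for arbitrary
   policies and on all paths, not just on almost all of them. *)
Lemma measurable_recognises (T : R) (pi : Omega -> \bar R) : 0 < T ->
  stopping_time Rp pi -> measurable (recognises_last_record Rp T pi).
Proof.
move=> T0 spi.
rewrite (_ : recognises_last_record Rp T pi =
    ([set w | (0%:E < pi w)%E] `&` [set w | (pi w < T%:E)%E]) `&`
    [set w | forall q : rat, 0 <= (ratr q : R) <= T ->
      (((ratr q)%:E < pi w)%E -> Rp (ratr q) w <> Rp T w) /\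
      ((pi w < (ratr q)%:E)%E -> Rp (ratr q) w = Rp T w)]); last first.
  apply/seteqP; split => w.
    by move=> /(recognisesP (Rp_jump w) (@Rp_noninc w) _ T0)[/andP[? ?] ?].
  move=> [[p0 pT] H]; apply/(recognisesP (Rp_jump w) (@Rp_noninc w) _ T0).
  by rewrite p0 pT.
apply: measurableI; first apply: measurableI.
- exact: measurable_stopping_time_gt.
- exact: measurable_stopping_time_lt.
apply: measurable_forall_rat => q; apply: measurable_imply_cst => /andP[q0 _].
apply: measurableI; apply: measurable_imply.
- exact: measurable_stopping_time_gt.
- by apply: measurableC; exact: measurable_eqr_set.
- exact: measurable_stopping_time_lt.
- exact: measurable_eqr_set.
Qed.

Lemma threshold_leP (T s t : R) w : 0 <= t ->
  (threshold_policy Rp T s w <= t%:E)%E <->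
  exists2 u, [/\ is_record (Rp ^~ w) u, u < T & (T - u) * Rp u w <= s] & u <= t.
Proof.
move=> t0; apply: (first_record_leP (Rp_jump w) (@Rp_noninc w)) => //.
by move=> u [].
Qed.

Lemma threshold_ge0 (T s : R) w : (0 <= threshold_policy Rp T s w)%E.
Proof. by apply: le_ereal_inf_tmp => _ [u [[/ltW u0 _] _ _] <-]. Qed.

Lemma threshold_stopping_time (T s : R) : 0 < T ->
  stopping_time Rp (threshold_policy Rp T s).
Proof.
move=> T0; split=> [w|t t0]; first exact: threshold_ge0.
pose E t := [set w | (threshold_policy Rp T s w <= t%:E)%E].
(* Before T, [record_in_regionP] describes the event by countably many conditions on the values of
   the path up to [u]. *)
have FE u : 0 <= u < T -> natural_filtration Rp u (E u).
  move=> /[dup] u0T /andP[u0 uT].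
  have RP w := @record_in_regionP R (Rp ^~ w) (Rp_jump w) (@Rp_noninc w) T s u u0T (Rp_gt0 w).
  rewrite (_ : E u = [set w | [/\ Rp 0 w <> Rp u w, (T - u) * Rp u w <= s &
      forall q : rat, 0 <= (ratr q : R) <= u -> s < (T - ratr q) * Rp u w ->
      Rp (ratr q) w <> Rp u w]]); last first.
    apply/seteqP; split => w; rewrite /E/=.
      by move=> /(threshold_leP _ _ _ u0)/(RP w).
    by move=> /(RP w) H; apply/(threshold_leP _ _ _ u0).
  have ad v (vu : 0 <= v <= u) := @adapted _ Omega R Rp v u vu.
  have uu : 0 <= u <= u by rewrite u0 lexx.
  rewrite (_ : [set _ | _] = [set w | Rp 0 w <> Rp u w] `&` ([set w | (T - u) * Rp u w <= s] `&`
      [set w | forall q : rat, 0 <= (ratr q : R) <= u -> s < (T - ratr q) * Rp u w ->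
      Rp (ratr q) w <> Rp u w])); last first.
    by apply/seteqP; split => w [] // ? [].
  apply: (@measurableI _ (g_sigma_algebraType _)).
    apply: (@measurableC _ (g_sigma_algebraType _)).
    by apply: (@measurable_eqr_set _ (g_sigma_algebraType _)); apply: ad; rewrite ?u0 lexx.
  apply: (@measurableI _ (g_sigma_algebraType _)).
    apply: (@measurable_ler_set _ (g_sigma_algebraType _)) => //.
    by apply: measurable_funM => //; exact: ad.
  apply: (@measurable_forall_rat _ (g_sigma_algebraType _)) => q.
  apply: (@measurable_imply_cst _ (g_sigma_algebraType _)) => qu.
  apply: (@measurable_imply _ (g_sigma_algebraType _)).
    apply: (@measurable_ltr_set _ (g_sigma_algebraType _)) => //.
    by apply: measurable_funM => //; exact: ad.
  apply: (@measurableC _ (g_sigma_algebraType _)).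
  by apply: (@measurable_eqr_set _ (g_sigma_algebraType _)); apply: ad.
apply: natural_filtration_right; have [tT|Tt] := ltP t T.
  by apply: FE; rewrite t0.
(* The policy stops strictly before T or never, so from T on the event is a union of events at
   earlier times. *)
rewrite (_ : [set _ | _] = \bigcup_n E (T - T / n.+1%:R)).
  apply: (@bigcup_measurable _ (g_sigma_algebraType _)) => n _.
  apply: (@natural_filtrationS _ _ _ _ (T - T / n.+1%:R)); last apply: FE.
    by rewrite (le_trans _ Tt)// gerBl divr_ge0// ltW.
  by rewrite gtrBl divr_gt0// andbT subr_ge0 ler_pdivrMr// ler_peMr ?ler1n// ltW.
apply/seteqP; split => w.
  move=> /(threshold_leP _ _ _ t0)[u [ru uT us] _].
  have /(lt_approxP (threshold_ge0 _ _ _) T0)[n] : (threshold_policy Rp T s w < T%:E)%E.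
    by apply: (@le_lt_trans _ _ u%:E); [apply: ereal_inf_lbound; exists u|rewrite lte_fin].
  by exists n.
move=> [n _ /le_trans]; apply; rewrite lee_fin (le_trans _ Tt)// gerBl.
by apply: divr_ge0 => //; exact: ltW.
Qed.

End step_process.

(** * Record paths *)

Section record_paths.
Context {R : realType} (r0 : R) (x e : nat -> R).
Hypotheses (r0_gt0 : 0 < r0) (x01 : forall j, 0 < x j < 1) (e_gt0 : forall j, 0 < e j).

Local Notation tau := (record_time r0 x e).
Local Notation rho := (record_state r0 x).

Lemma record_stateS k : rho k.+1 = rho k * x k.
Proof. by rewrite /record_state big_ord_recr/= mulrA. Qed.

Lemma record_timeS k : tau k.+1 = tau k + e k / rho k.
Proof. by rewrite /record_time big_ord_recr. Qed.

Lemma record_time0 : tau 0 = 0.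
Proof. by rewrite /record_time big_ord0. Qed.

Lemma record_state_gt0 k : 0 < rho k.
Proof.
elim: k => [|k IH]; first by rewrite /record_state big_ord0 mulr1.
by rewrite record_stateS mulr_gt0//; have /andP[] := x01 k.
Qed.

Lemma record_state_lt k : rho k.+1 < rho k.
Proof.
by rewrite record_stateS gtr_pMr ?record_state_gt0//; have /andP[] := x01 k.
Qed.

Lemma record_time_lt k : tau k < tau k.+1.
Proof. by rewrite record_timeS ltrDl divr_gt0// record_state_gt0. Qed.

Lemma record_time_le m n : (m <= n)%N -> tau m <= tau n.
Proof.
by move: m n; apply/nondecreasing_seqP => k; exact/ltW/record_time_lt.
Qed.

Lemma record_time_ge0 k : 0 <= tau k.
Proof. by rewrite -record_time0 record_time_le. Qed.

Lemma record_time_lt_iff m n : (tau m < tau n) = (m < n)%N.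
Proof.
have [nm|mn] := leqP n m; first by apply/negbTE; rewrite -leNgt record_time_le.
by rewrite (lt_le_trans (record_time_lt m))// record_time_le.
Qed.

Lemma record_index_unique k l t : tau k <= t < tau k.+1 -> tau l <= t < tau l.+1 -> k = l.
Proof.
move=> /andP[kt tk] /andP[lt_ tl]; apply/eqP; rewrite eqn_leq.
by apply/andP; split; rewrite -ltnS -record_time_lt_iff;
  [exact: le_lt_trans tl|exact: le_lt_trans tk].
Qed.

(** The next scaled time depends only on the present one and on [e k], [x k]. This reduces the
    events at the k-th record to [quiet] and [single]. *)
Lemma scaled_timeS T k :
  (T - tau k.+1) * rho k.+1 = ((T - tau k) * rho k - e k) * x k.
Proof.
rewrite record_timeS record_stateS; field.
by rewrite gt_eqF// record_state_gt0.
Qed.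

Lemma scaled_time_le (T s : R) m n : (m <= n)%N -> tau n < T ->
  (T - tau m) * rho m <= s -> (T - tau n) * rho n <= s.
Proof.
move=> mn; rewrite -(subnK mn) addnC; elim: (n - m)%N => [|k IH]; first by rewrite addn0.
rewrite addnS => tT /IH H; apply: (le_trans _ (H _)).
  rewrite ler_pM//.
  - by rewrite subr_ge0 ltW.
  - by rewrite ltW// record_state_gt0.
  - by rewrite lerB// ltW// record_time_lt.
  - by rewrite ltW// record_state_lt.
by rewrite (lt_trans _ tT)// record_time_lt.
Qed.

Variable f : R -> R.
Hypothesis fjump : jump_path f.
Hypothesis fnoninc : forall s t, 0 <= s -> s <= t -> f t <= f s.
Hypothesis fE : forall k t, tau k <= t < tau k.+1 -> f t = rho k.

Let f_tau k : f (tau k) = rho k.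
Proof. by apply: fE; rewrite lexx record_time_lt. Qed.

(* A path that jumps infinitely often before [t] is not constant to the left
   of the supremum of its jump times. *)
Lemma record_time_cover t : 0 <= t -> exists k, tau k <= t < tau k.+1.
Proof.
move=> t0; apply: contrapT => nk.
have taut k : tau k <= t.
  elim: k => [|k IH]; first by rewrite record_time0.
  by rewrite leNgt; apply/negP => tk; apply: nk; exists k; rewrite IH.
have st : has_sup (range tau).
  by split; [exists (tau 0%N), 0%N|exists t => _ [k _ <-]].
have tauL k : tau k < sup (range tau).
  by rewrite (lt_le_trans (record_time_lt k))//; apply: (sup_upper_bound st); exists k.+1.
have L0 : 0 < sup (range tau) by rewrite -record_time0 tauL.
have [a /andP[a0 aL] fa] := jump_path_left fjump L0.
have aL' : 0 < sup (range tau) - a by rewrite subr_gt0.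
have [_ [k _ <-]] := sup_adherent aL' st; rewrite subKr => ak.
have : f (tau k) = f (tau k.+1).
  rewrite (fa (tau k)) ?(fa (tau k.+1))// tauL andbT ltW//.
  by rewrite (lt_trans ak) ?record_time_lt.
by rewrite !f_tau => /eqP; rewrite gt_eqF// record_state_lt.
Qed.

Lemma is_record_time t : is_record f t <-> exists k, t = tau k.+1.
Proof.
split=> [/(is_recordP fjump fnoninc)[t0 ft]|[k ->]].
  have [k /andP[kt tk]] := record_time_cover (ltW t0).
  have tE : t = tau k.
    apply/eqP; rewrite eq_le kt andbT leNgt; apply/negP => kt'.
    have := ft (tau k); rewrite record_time_ge0 kt' => /(_ isT).
    by rewrite f_tau (fE (k := k)) ?ltxx// kt.
  by case: k tE {kt tk} => [|k] tE; [rewrite tE record_time0 ltxx in t0|exists k].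
apply/(is_recordP fjump fnoninc); split.
  by rewrite (le_lt_trans (record_time_ge0 k))// record_time_lt.
move=> s /andP[s0 sk]; rewrite f_tau; have [ks|sk'] := leP (tau k) s.
  by rewrite (fE (k := k)) ?ks// record_state_lt.
by rewrite (lt_le_trans (record_state_lt k))// -f_tau fnoninc// ltW.
Qed.

Lemma recognises_record_time (T : R) (p : \bar R) : 0 < T ->
  (exists t : R, [/\ p = t%:E, is_record f t, f t = f T & t < T]) <->
  exists2 k, p = (tau k.+1)%:E & tau k.+1 < T < tau k.+2.
Proof.
move=> T0; split=> [[t [-> /is_record_time[k tE] ftT tT]]|[k -> /andP[kT Tk]]].
  exists k; rewrite -tE// tT/= ltNge; apply/negP => kT.
  have : rho k.+2 < rho k.+2; last by rewrite ltxx.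
    rewrite (lt_le_trans (record_state_lt k.+1))// -!f_tau -tE ftT fnoninc//.
    exact: record_time_ge0.
exists (tau k.+1); split=> //; first by apply/is_record_time; exists k.
by rewrite f_tau (fE (k := k.+1))// Tk ltW.
Qed.

(** Only the preceding record has to be checked, since a record in the region is followed before T
    by records in the region. The guard [0 < k] is there because the predecessor of the first record
    is time 0, which may lie in the region but is no record. *)
Lemma first_record_in_region (T s : R) k : tau k.+1 < T -> (T - tau k.+1) * rho k.+1 <= s ->
    ((0 < k)%N -> s < (T - tau k) * rho k) ->
  ereal_inf [set t%:E | t in
    [set t | [/\ is_record f t, t < T & (T - t) * f t <= s]]] = (tau k.+1)%:E.
Proof.
move=> kT ks prev; apply/eqP; rewrite eq_le; apply/andP; split.
  apply: ereal_inf_lbound; exists (tau k.+1) => //; split=> //.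
    by apply/is_record_time; exists k.
  by rewrite f_tau.
apply: le_ereal_inf_tmp => _ [u [/is_record_time[m ->] mT +] <-]; rewrite f_tau => ms.
rewrite lee_fin leNgt; apply/negP; rewrite record_time_lt_iff ltnS => mk.
have := prev (leq_ltn_trans (leq0n _) mk).
rewrite ltNge => /negP; apply; apply: scaled_time_le ms => //.
by rewrite (lt_trans _ kT)// record_time_lt.
Qed.

End record_paths.

(** * Independence of the past from the next draws *)

Section independence.
Local Open Scope ereal_scope.
Context d (Omega : measurableType d) (R : realType) (P : probability Omega R).
Implicit Types C F : set Omega.

Lemma probability_setI_full C F : measurable C -> measurable F -> P F = 1 ->
  P (C `&` F) = P C.
Proof.
move=> mC mF F1; rewrite [RHS](measureDI P mC mF).
have F0 : P (~` F) = 0 by rewrite probability_setC// F1 subee.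
rewrite -[LHS]add0e; congr (_ + _); apply/esym.
apply: subset_measure0 F0; [exact: measurableD|exact: measurableC|].
by move=> w [].
Qed.

(** As functions of [C] both sides are finite measures, and they agree on a class that is stable
    under intersection and contains the whole space. *)
Lemma independent_generated (G : set (set Omega)) F : G `<=` measurable ->
    setI_closed G -> G setT -> measurable F ->
    (forall C, G C -> P (C `&` F) = P C * P F) ->
  forall C, <<s G >> C -> P (C `&` F) = P C * P F.
Proof.
move=> Gm GI GT mF GF C sC.
have PF0 : (0 <= fine (P F))%R by rewrite fine_ge0.
rewrite -[P F]fineK ?fin_num_measure// muleC.
apply: (g_sigma_algebra_measure_unique G Gm (fun=> setT) _ _
  (mrestr P mF) (mscale (NngNum PF0) P)) => //.
- by rewrite bigcup_const.
- move=> A GA; apply: (etrans (GF A GA)); rewrite muleC; congr (_ * _).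
  by rewrite -[LHS]fineK ?fin_num_measure.
- move=> k; apply: (le_lt_trans (probability_le1 P _)); last exact: ltry.
  exact: measurableI.
Qed.

Lemma pair_law d1 d2 (T1 : measurableType d1) (T2 : measurableType d2) C
    (Y : Omega -> T1) (Z : Omega -> T2) (n : {measure set (T1 * T2) -> \bar R}) :
    measurable C -> measurable_fun setT Y -> measurable_fun setT Z ->
    (forall A B, measurable A -> measurable B ->
       P (C `&` [set w | A (Y w) /\ B (Z w)]) = n (A `*` B)) ->
  forall D, measurable D -> P (C `&` [set w | D (Y w, Z w)]) = n D.
Proof.
move=> mC mY mZ rect D mD.
have mYZ : measurable_fun setT (fun w => (Y w, Z w)) by exact: measurable_fun_pair.
pose rects := [set A `*` B | A in @measurable _ T1 & B in @measurable _ T2].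
have mE : measurable = <<s rects >> by exact: measurable_prod_measurableType.
pose law : {measure set (T1 * T2) -> \bar R} := pushforward (mrestr P mC) (fun w => (Y w, Z w)).
have lawE A : P (C `&` [set w | A (Y w, Z w)]) = law mYZ A.
  by rewrite /law/= /pushforward/= /mrestr setIC.
rewrite lawE; have : <<s rects >> D by rewrite -mE.
apply: (g_sigma_algebra_measure_unique rects _ (fun=> setT)) => //.
- by move=> _ [A mA [B mB <-]]; exact: measurableX.
- by move=> _; exists setT => //; exists setT => //; rewrite setXTT.
- by rewrite bigcup_const.
- move=> _ _ [A mA [B mB <-]] [A' mA' [B' mB' <-]]; rewrite -setXI.
  by exists (A `&` A'); [exact: measurableI|exists (B `&` B'); [exact: measurableI|]].
- by move=> _ [A mA [B mB <-]]; rewrite -lawE rect.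
- move=> k; rewrite -(lawE setT); apply: (le_lt_trans (probability_le1 _ _)); last exact: ltry.
  by apply: measurableI => //; exact: measurableT.
Qed.

End independence.

Section past.
Context d (Omega : measurableType d) (R : realType) (P : probability Omega R).
Variables (X_ E_ : nat -> {RV P >-> R}) (mX m : probability R R).

Let Z (i : nat + nat) : {RV P >-> R} := match i with inl j => X_ j | inr j => E_ j end.

Hypothesis lawX : forall j A, measurable A -> P (X_ j @^-1` A) = mX A.
Hypothesis lawE : forall j A, measurable A -> P (E_ j @^-1` A) = m A.
Hypothesis indep : mutually_independent Z.

Definition before k (i : nat + nat) : bool := match i with inl j | inr j => (j < k)%N end.

Definition past_cylinder k (A : nat + nat -> set R) : set Omega :=
  [set w | forall i, before k i -> A i (Z i w)].

(* Intersecting the cylinders with almost sure events puts the null sets in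
   the generated sigma-algebra without harming independence. *)
Definition past_generator k : set (set Omega) :=
  [set C | exists A M, [/\ forall i, measurable (A i), measurable M, P M = 1%E &
                           C = past_cylinder k A `&` M]].

Definition past k : measurableType _ := g_sigma_algebraType (past_generator k).

(** Indices run up to k + 1 because the next draws include the clock E_{k+1}. *)
Let horizon k : {fset (nat + nat)} :=
  seq_fset tt ([seq inl j | j <- iota 0 k.+2] ++ [seq inr j | j <- iota 0 k.+2]).

Let horizonE k i : (i \in horizon k) = before k.+2 i.
Proof.
rewrite seq_fsetE mem_cat; case: i => j; apply/orP/idP.
- by case=> /mapP[l]; rewrite mem_iota add0n => lk [->].
- by move=> jk; left; apply/mapP; exists j; rewrite ?mem_iota.
- by case=> /mapP[l]; rewrite mem_iota add0n => lk [->].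
- by move=> jk; right; apply/mapP; exists j; rewrite ?mem_iota.
Qed.

Lemma past_cylinderE k A : past_cylinder k A =
  \bigcap_(i in [set` horizon k]) (Z i @^-1` (if before k i then A i else setT)).
Proof.
apply/seteqP; split => w /= Aw i; first by move=> _; case: ifPn => // /Aw.
move=> ki; have := Aw i; rewrite /= ki; apply; rewrite horizonE.
by case: i ki => j /= jk; rewrite (ltn_trans jk).
Qed.

Lemma measurable_past_cylinder k A : (forall i, measurable (A i)) ->
  measurable (past_cylinder k A).
Proof.
move=> mA; rewrite past_cylinderE; apply: fin_bigcap_measurable => // i _.
by apply: measurable_funPTI => //; case: ifP.
Qed.

Definition future_event k (B1 B2 B3 : set R) : set Omega :=
  [set w | B1 (X_ k w) /\ B2 (E_ k w) /\ B3 (E_ k.+1 w)].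

(** Both events are rectangles over [horizon k], so independence turns them into products. The
    factors of the three next draws split off, and the remaining factors are the same on both
    sides. *)
Lemma past_cylinder_future k A B1 B2 B3 : (forall i, measurable (A i)) ->
    measurable B1 -> measurable B2 -> measurable B3 ->
  P (past_cylinder k A `&` future_event k B1 B2 B3) =
    (P (past_cylinder k A) * (mX B1 * (m B2 * m B3)))%E.
Proof.
move=> mA mB1 mB2 mB3.
pose A' i := if before k i then A i else setT.
pose B' i := if before k i then A i else match i with
  | inl j => if j == k then B1 else setT
  | inr j => if j == k then B2 else if j == k.+1 then B3 else setT end.
have mA' i : measurable (A' i) by rewrite /A'; case: ifP.
have mB' i : measurable (B' i).
  by rewrite /B'; case: ifP => // _; case: i => j; do 2 ?case: ifP.
have -> : past_cylinder k A `&` future_event k B1 B2 B3 =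
    \bigcap_(i in [set` horizon k]) (Z i @^-1` B' i).
  apply/seteqP; split => w /=.
    move=> [Aw [B1w [B2w B3w]]] i _; rewrite /B'/=; case: ifPn => [/Aw//|_].
    by case: i => j /=; do 2 ?[case: ifPn => [/eqP->|_]//].
  move=> Bw; split=> [i ki|].
    have := Bw i; rewrite /B' ki; apply; rewrite /= horizonE.
    by case: i ki => j /= jk; rewrite (ltn_trans jk).
  split; [|split].
  - by have := Bw (inl k); rewrite /B'/= ltnn eqxx; apply; rewrite horizonE/= ltnS leqnSn.
  - by have := Bw (inr k); rewrite /B'/= ltnn eqxx; apply; rewrite horizonE/= ltnS leqnSn.
  - have := Bw (inr k.+1); rewrite /B'/= ltnNge leqnSn eqxx gtn_eqF//=; apply.
    by rewrite horizonE/= ltnS.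
rewrite past_cylinderE (indep _ mB') (indep _ mA').
have k1 : inl k \in horizon k by rewrite horizonE/= ltnS leqnSn.
have k2 : inr k \in (horizon k `\ inl k)%fset by rewrite !inE horizonE/= ltnS leqnSn.
have k3 : inr k.+1 \in (horizon k `\ inl k `\ inr k)%fset.
  by rewrite !inE horizonE/= ltnSn !andbT; apply/eqP => -[/esym/eqP]; rewrite ltn_eqF.
rewrite !(big_fsetD1 _ k1) !(big_fsetD1 _ k2) !(big_fsetD1 _ k3)/=.
rewrite /A' /B'/= !ltnn ltnNge leqnSn !eqxx gtn_eqF//= !preimage_setT !probability_setT.
rewrite !mul1e lawX// !lawE// [RHS]muleC !muleA; congr (_ * _)%E.
apply: eq_big_seq => i; rewrite !inE => /and4P[i3 i2 i1 _].
case: ifP => // _; case: i i1 i2 i3 => j i1 i2 i3.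
  by have /negbTE -> : j != k := i1.
by have /negbTE -> : j != k := i2; have /negbTE -> : j != k.+1 := i3.
Qed.

Lemma past_measurable k : @measurable _ (past k) `<=` @measurable _ Omega.
Proof.
apply: smallest_sub; first exact: sigma_algebra_measurable.
move=> _ [A [M [mA mM _ ->]]].
by apply: measurableI => //; exact: measurable_past_cylinder.
Qed.

Lemma measurable_future_event k B1 B2 B3 :
  measurable B1 -> measurable B2 -> measurable B3 -> measurable (future_event k B1 B2 B3).
Proof. by move=> ? ? ?; do 2?apply: measurableI; exact: measurable_funPTI. Qed.

Let cylT k : past_cylinder k (fun=> setT) = setT.
Proof. by apply/seteqP; split. Qed.

Lemma past_future k C B1 B2 B3 : measurable (C : set (past k)) ->
    measurable B1 -> measurable B2 -> measurable B3 ->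
  P (C `&` future_event k B1 B2 B3) = (P C * (mX B1 * (m B2 * m B3)))%E.
Proof.
move=> pC mB1 mB2 mB3.
have mF := measurable_future_event k mB1 mB2 mB3.
have PF : P (future_event k B1 B2 B3) = (mX B1 * (m B2 * m B3))%E.
  have := past_cylinder_future k (A := fun=> setT) (fun=> measurableT) mB1 mB2 mB3.
  by rewrite cylT setTI probability_setT mul1e.
rewrite -PF; apply: (independent_generated (G := past_generator k)) pC => //.
- by move=> A GA; apply: (@past_measurable k); exact: sub_sigma_algebra.
- move=> _ _ [A [M [mA mM M1 ->]]] [A' [M' [mA' mM' M1' ->]]].
  exists (fun i => A i `&` A' i), (M `&` M'); split.
  + by move=> i; exact: measurableI.
  + exact: measurableI.
  + by rewrite probability_setI_full.
  + rewrite setIACA; congr (_ `&` _); apply/seteqP; split => w /=.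
      by move=> [Aw Aw'] i ki; split; [exact: Aw|exact: Aw'].
    by move=> Aw; split => i /Aw[].
- exists (fun=> setT), setT; split => //; first exact: probability_setT.
  by rewrite cylT setIT.
- move=> _ [A [M [mA mM M1 ->]]].
  have mA' := measurable_past_cylinder k mA.
  rewrite setIAC (probability_setI_full _ mM M1); last exact: measurableI.
  by rewrite (probability_setI_full mA' mM M1) past_cylinder_future// PF.
Qed.

Lemma past_full k (M : set Omega) : measurable M -> P M = 1%E -> measurable (M : set (past k)).
Proof.
move=> mM M1; apply: sub_sigma_algebra; exists (fun=> setT), M; split => //.
by rewrite cylT setTI.
Qed.

Lemma past_driving k j : (j < k)%N ->
  measurable_fun setT (X_ j : past k -> R) /\ measurable_fun setT (E_ j : past k -> R).
Proof.
move=> jk; split=> _ B mB; rewrite setTI; apply: sub_sigma_algebra.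
- exists (fun i => if i is inl l then if l == j then B else setT else setT), setT.
  split => //; last 2 first.
  + exact: probability_setT.
  + rewrite setIT; apply/seteqP; split => w /=.
      by move=> Bw [l|l] //= lk; case: eqP => // ->.
    by move=> /(_ (inl j) jk)/=; rewrite eqxx.
  by case=> // l; case: ifP.
- exists (fun i => if i is inr l then if l == j then B else setT else setT), setT.
  split => //; last 2 first.
  + exact: probability_setT.
  + rewrite setIT; apply/seteqP; split => w /=.
      by move=> Bw [l|l] //= lk; case: eqP => // ->.
    by move=> /(_ (inr j) jk)/=; rewrite eqxx.
  by case=> // l; case: ifP.
Qed.

Lemma past_le k l : (k <= l)%N -> @measurable _ (past k) `<=` @measurable _ (past l).
Proof.
move=> kl; apply: smallest_sub; first exact: smallest_sigma_algebra.
move=> _ [A [M [mA mM M1 ->]]]; apply: sub_sigma_algebra.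
exists (fun i => if before k i then A i else setT), M; split => //.
  by move=> i; case: ifP.
congr (_ `&` _); apply/seteqP; split => w /= Aw i.
  by move=> _; case: ifP => // /Aw.
move=> ki; have := Aw i; rewrite ki; apply.
by case: i ki => j /= jk; exact: leq_trans kl.
Qed.

End past.

Section pair_law_scaled.
Local Open Scope ereal_scope.
Context d (Omega : measurableType d) (R : realType) (P : probability Omega R).

Lemma pair_law_scaled d1 d2 (T1 : measurableType d1) (T2 : measurableType d2) (C : set Omega)
    (Y : Omega -> T1) (Z : Omega -> T2) (c : \bar R) (n : {measure set (T1 * T2) -> \bar R}) :
    measurable C -> measurable_fun setT Y -> measurable_fun setT Z ->
    c \is a fin_num -> 0 <= c ->
    (forall A B, measurable A -> measurable B ->
       P (C `&` [set w | A (Y w) /\ B (Z w)]) = c * n (A `*` B)) ->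
  forall D, measurable D -> P (C `&` [set w | D (Y w, Z w)]) = c * n D.
Proof.
move=> mC mY mZ cfin c0 rect D mD; have c0' : (0 <= fine c)%R by exact: fine_ge0.
rewrite -[c]fineK// in rect *.
exact: (pair_law (n := mscale (NngNum c0') n)).
Qed.

End pair_law_scaled.

(** * Freezing the scaled time and integrating out the next draws *)

Section freezing.
Context d (Omega : measurableType d) (R : realType) (P : probability Omega R).
Variables (X_ E_ : nat -> {RV P >-> R}) (mX m : probability R R).

Hypothesis lawX : forall j A, measurable A -> P (X_ j @^-1` A) = mX A.
Hypothesis lawE : forall j A, measurable A -> P (E_ j @^-1` A) = m A.
Hypothesis indep : mutually_independent
  (fun i : nat + nat => match i with inl j => X_ j | inr j => E_ j end).

Local Notation past := (past X_ E_).

Definition next_draws k w : R * (R * R) := (X_ k w, (E_ k w, E_ k.+1 w)).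

Lemma measurable_next_draws k : measurable_fun setT (next_draws k).
Proof. by apply: measurable_fun_pair => //; exact: measurable_fun_pair. Qed.

(** The triple is built in two passes over rectangles: the factor against the pair of clocks, then
    one clock against the other, with the condition on the factor absorbed into the conditioning
    event. *)
Lemma next_draws_law k (C : set Omega) D : measurable (C : set (past k)) -> measurable D ->
  P (C `&` [set w | D (next_draws k w)]) = (P C * future mX m D)%E.
Proof.
move=> pC mD; have mC := past_measurable pC.
apply: (pair_law_scaled (n := future mX m)) => //.
- exact: measurable_fun_pair.
- exact: fin_num_measure.
move=> A B mA mB; transitivity (P C * (mX A * clocks m B))%E; last first.
  by congr (_ * _)%E; exact/esym/future_rect.
rewrite muleA (_ : _ `&` _ = (C `&` X_ k @^-1` A) `&` [set w | B (E_ k w, E_ k.+1 w)]); last first.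
  by apply/seteqP; split => w /=; tauto.
apply: (pair_law_scaled (n := clocks m)) => //.
- by apply: measurableI => //; exact: measurable_funPTI.
- by rewrite fin_numM ?fin_num_measure.
- exact: mule_ge0.
move=> B1 B2 mB1 mB2; transitivity (P C * mX A * (m B1 * m B2))%E; last first.
  by congr (_ * _)%E; exact/esym/clocks_rect.
rewrite -muleA -(past_future lawX lawE indep pC)//.
by congr (P _); apply/seteqP; split => w; rewrite /future_event/=; tauto.
Qed.

Variables (k : nat) (C : set Omega) (S : Omega -> R).
Hypothesis pC : measurable (C : set (past k)).
Hypothesis pS : measurable_fun setT (S : past k -> R).

(** Since [S] is known from the past and the next draws are independent of it, the joint law on [C]
    is a product. Each probability is thus an integral over the values of [S], and the integrands
    are compared pointwise. *)
Lemma freeze_le (I : set R) (D1 D2 : set (R * (R * (R * R)))) :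
    measurable I -> measurable D1 -> measurable D2 ->
    (forall w, C w -> I (S w)) ->
    (forall s, I s -> (future mX m (xsection D1 s) <= future mX m (xsection D2 s))%E) ->
  (P (C `&` [set w | D1 (S w, next_draws k w)]) <= P (C `&` [set w | D2 (S w, next_draws k w)]))%E.
Proof.
move=> mI mD1 mD2 CI D12; have mC := past_measurable pC.
have mS : measurable_fun setT S.
  by move=> _ B mB; apply: past_measurable; exact: pS.
pose law : {measure set R -> \bar R} := pushforward (mrestr P mC) S.
have frozen D : measurable D -> P (C `&` [set w | D (S w, next_draws k w)]) =
    (\int[law mS]_(s in I) future mX m (xsection D s))%E.
  (* Cutting [D] down to [I] costs nothing on [C] and confines the integral to the values for which
     the comparison is assumed. *)
  move=> mD; transitivity (P (C `&` [set w | (D `&` (I `*` setT)) (S w, next_draws k w)])).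
    congr (P _); apply/seteqP; split => w /= [Cw Dw]; last by case: Dw.
    by split=> //; split=> //; split=> //; exact: CI.
  have mDI : measurable (D `&` (I `*` setT)).
    by apply: measurableI => //; exact: measurableX.
  have mnext := measurable_next_draws k.
  transitivity ((law mS \x future mX m)%E (D `&` (I `*` setT))).
    apply: (pair_law (n := (law mS \x future mX m)%E) mC mS mnext _ mDI) => A B mA mB.
    transitivity (law mS A * future mX m B)%E; last exact/esym/product_measure1E.
    transitivity (P ((C `&` S @^-1` A) `&` [set w | B (next_draws k w)])).
      by congr (P _); apply/seteqP; split => w /=; tauto.
    have pSA : measurable (S @^-1` A : set (past k)).
      by have := pS measurableT mA; rewrite setTI.
    rewrite next_draws_law//; last exact: measurableI.
    by rewrite setIC.
  transitivity (\int[law mS]_s future mX m (xsection (D `&` (I `*` setT)) s))%E; first by [].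
  rewrite [RHS]integral_mkcond; apply: eq_integral => s _.
  rewrite patchE; case: ifPn => [|]; rewrite ?notin_setE ?inE => sI.
    congr (future _ _ _); apply/seteqP; split => z; rewrite /xsection/= !inE//=.
    by case.
  rewrite (_ : xsection _ s = set0) ?measure0//.
  by apply/seteqP; split => z //; rewrite /xsection/= inE => -[_ []].
rewrite (frozen _ mD1) (frozen _ mD2).
move: (future mX m) D12 => nu D12.
apply: ge0_le_integral => //.
- by apply: measurable_funTS; exact: measurable_fun_xsection.
- by apply: measurable_funTS; exact: measurable_fun_xsection.
Qed.

Hypothesis mX01 : mX `]0, 1[%classic = 1%E.
Hypothesis mE : forall A, measurable A -> m A = exponential_prob 1 A.
Variable sstar : R.
Hypotheses (sstar_gt0 : 0 < sstar) (Phi_sstar : Phi mX sstar = 1).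

Let quiets : set (R * (R * (R * R))) := [set p | quiet p.1 p.2].
Let singles : set (R * (R * (R * R))) := [set p | single p.1 p.2].

Let m1 : measurable_fun setT (fun p : R * (R * (R * R)) => p.2.1).
Proof. exact: (measurableT_comp measurable_fst measurable_snd). Qed.

Let m2 : measurable_fun setT (fun p : R * (R * (R * R)) => p.2.2.1).
Proof.
apply: (measurableT_comp measurable_fst).
exact: (measurableT_comp measurable_snd measurable_snd).
Qed.

Let m3 : measurable_fun setT (fun p : R * (R * (R * R)) => p.2.2.2).
Proof.
apply: (measurableT_comp measurable_snd).
exact: (measurableT_comp measurable_snd measurable_snd).
Qed.

Let measurable_quiets : measurable quiets.
Proof. exact: measurable_ltr_set. Qed.

Let measurable_singles : measurable singles.
Proof.
apply: measurableI; apply: measurable_ltr_set => //.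
by apply: measurable_funM => //; exact: measurable_funB.
Qed.

Let quietsE s : xsection quiets s = quiet s.
Proof. by apply/seteqP; split => z; rewrite /xsection/= inE. Qed.

Let singlesE s : xsection singles s = single s.
Proof. by apply/seteqP; split => z; rewrite /xsection/= inE. Qed.

(** The two frozen probabilities share the factor exp(-s), so what is compared is [Phi mX s] with
    its value 1 at [sstar]. *)
Lemma single_le_quiet : (forall w, C w -> 0 < S w <= sstar) ->
  (P (C `&` [set w | single (S w) (next_draws k w)]) <=
   P (C `&` [set w | quiet (S w) (next_draws k w)]))%E.
Proof.
move=> CS.
apply: (freeze_le (measurable_itv `]0, sstar]) measurable_singles measurable_quiets).
  by move=> w /CS; rewrite /= in_itv.
move=> s; rewrite /= in_itv/= => /andP[s0 ss]; rewrite quietsE singlesE.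
rewrite [leLHS](single_prob mX01 mE s0) [leRHS](quiet_prob mX mE (ltW s0)) lee_fin.
by rewrite ler_piMr ?expR_ge0// -Phi_sstar Phi_le// ltW.
Qed.

Lemma quiet_le_single : (forall w, C w -> sstar < S w) ->
  (P (C `&` [set w | quiet (S w) (next_draws k w)]) <=
   P (C `&` [set w | single (S w) (next_draws k w)]))%E.
Proof.
move=> CS.
apply: (freeze_le (measurable_itv `]sstar, +oo[) measurable_quiets measurable_singles).
  by move=> w /CS; rewrite /= in_itv/= andbT.
move=> s; rewrite /= in_itv/= andbT => ss; rewrite quietsE singlesE.
have s0 := lt_trans sstar_gt0 ss.
rewrite [leRHS](single_prob mX01 mE s0) [leLHS](quiet_prob mX mE (ltW s0)) lee_fin.
by rewrite ler_peMr ?expR_ge0// -Phi_sstar Phi_le// ltW.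
Qed.

End freezing.

(** * Policies seen at the jump times *)

Section stopping_in_past.
Context d (Omega : measurableType d) (R : realType) (P : probability Omega R).
Variables (X_ E_ : nat -> {RV P >-> R}) (r0 : R) (Rp : R -> {RV P >-> R}).
Hypothesis r0_gt0 : 0 < r0.
Hypothesis Rp_jump : forall w, jump_path (Rp ^~ w).

Let tau k w := record_time r0 (X_ ^~ w) (E_ ^~ w) k.
Let rho k w := record_state r0 (X_ ^~ w) k.
Local Notation past := (past X_ E_).

Definition regular : set Omega := [set w | [/\ forall j, 0 < X_ j w < 1, forall j, 0 < E_ j w &
  forall k t, tau k w <= t < tau k.+1 w -> Rp t w = rho k w]].

Lemma past_measurable_fun_le k l (f : Omega -> R) : (k <= l)%N ->
  measurable_fun setT (f : past k -> R) -> measurable_fun setT (f : past l -> R).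
Proof.
by move=> kl mf _ B mB; apply: (past_le kl); exact: mf.
Qed.

Lemma past_record_state k : measurable_fun setT (rho k : past k -> R).
Proof.
elim: k => [|k IH].
  rewrite (_ : rho 0 = cst r0); first exact: measurable_cst.
  by apply/funext => w; rewrite /rho /record_state big_ord0 mulr1.
rewrite (_ : rho k.+1 = rho k \* X_ k)%R; last by apply/funext => w; rewrite /rho record_stateS.
apply: measurable_funM; first exact: past_measurable_fun_le IH.
by have [] := @past_driving _ _ _ _ X_ E_ k.+1 k (leqnn _).
Qed.

Lemma past_record_time k : measurable_fun setT (tau k : past k -> R).
Proof.
elim: k => [|k IH].
  rewrite (_ : tau 0 = cst 0); first exact: measurable_cst.
  by apply/funext => w; rewrite /tau record_time0.
rewrite (_ : tau k.+1 = (fun w => tau k w + E_ k w * (rho k w)^-1)); last first.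
  by apply/funext => w; rewrite /tau record_timeS.
apply: measurable_funD; first exact: past_measurable_fun_le IH.
apply: measurable_funM.
  by have [] := @past_driving _ _ _ _ X_ E_ k.+1 k (leqnn _).
apply: (measurableT_comp measurable_invr).
by apply: (past_measurable_fun_le (leqnSn k)); exact: past_record_state.
Qed.

(** When [q] falls in the k-th sojourn, the path up to [q] is a function of the first k factors and
    clocks. The events that agree there with a past event form a sigma-algebra, so it is enough to
    treat those given by one value of the path. *)
Lemma filtration_past q k (A : set Omega) : natural_filtration Rp q A ->
  exists2 A' : set (past k), measurable A' &
    forall w, regular w -> tau k w <= q < tau k.+1 w -> (A w <-> A' w).
Proof.
pose H := [set A : set Omega | exists2 A' : set (past k), measurable A' &
    forall w, regular w -> tau k w <= q < tau k.+1 w -> (A w <-> A' w)].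
suff : natural_filtration Rp q `<=` H by apply.
apply: smallest_sub.
  split.
  - by exists set0.
  - move=> B [B' mB' BB']; exists (~` B'); first exact: measurableC.
    by move=> w rw kq; rewrite setTD /=; split => nB /(BB' w rw kq).
  - move=> F HF.
    have /choice[F' F'P] : forall n, exists A' : set (past k), measurable A' /\
        forall w, regular w -> tau k w <= q < tau k.+1 w -> (F n w <-> A' w).
      by move=> n; have [A' ? ?] := HF n; exists A'.
    exists (\bigcup_n F' n); first by apply: bigcup_measurable => n _; exact: (F'P n).1.
    by move=> w rw kq; split => -[n _ Fn]; exists n => //; apply/((F'P n).2 w rw kq).
move=> A1 [u /=]; rewrite in_itv/= => /andP[u0 uq] [B mB <-]; rewrite setTI.
pose E j := [set w | tau j w <= u] `&` rho j @^-1` B.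
have mE j : measurable (E j : set (past j)).
  apply: measurableI.
    by apply: measurable_ler_set; [exact: past_record_time|exact: measurable_cst].
  by rewrite -[_ @^-1` _]setTI; exact: past_record_state.
(* The union runs over the sojourn that contains [u]. For j = k the bound u < tau_{k+1} is left out:
   it follows from q < tau_{k+1}, and it would involve the clock E_k, which is not among the draws
   generating [past k]. *)
exists (E k `|` \bigcup_(j in [set j | (j < k)%N]) (E j `&` [set w | u < tau j.+1 w])).
  apply: measurableU; first exact: mE.
  apply: bigcup_measurable => j /= jk; apply: measurableI.
    by apply: (past_le (ltnW jk)); exact: mE.
  apply: (past_le jk).
  by apply: measurable_ltr_set; [exact: measurable_cst|exact: past_record_time].
move=> w [x01 e0 RpE] /andP[kq qk]; split=> /=.
  have [j /andP[ju uj]] := record_time_cover r0_gt0 x01 e0 (Rp_jump w) RpE u0.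
  rewrite (RpE j) ?ju// => Bj.
  have : (j <= k)%N.
    rewrite -ltnS -(record_time_lt_iff r0_gt0 x01 e0).
    exact: le_lt_trans (le_lt_trans uq qk).
  rewrite leq_eqVlt => /orP[/eqP jk|jk]; first by left; rewrite -jk; split.
  by right; exists j.
move=> [[ku Bk]|[j jk [[ju Bj] uj]]].
  by rewrite (RpE k)// ku (le_lt_trans uq).
by rewrite (RpE j)// ju.
Qed.

(* [pi <= tau_k] is decided by the events [pi < q] for rational [q] decreasing
   to [tau_k]; past information describes these as soon as [q < tau_{k+1}]. *)
Lemma stopped_past (pi : Omega -> \bar R) (M : set Omega) k :
    stopping_time Rp pi -> measurable M -> P M = 1%E -> M `<=` regular ->
  measurable ([set w | (pi w <= (tau k w)%:E)%E] `&` M : set (past k)).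
Proof.
move=> spi mM M1 Mreg.
have /choice[A' A'P] : forall q : rat, exists A' : set (past k), measurable A' /\
    (0 < (ratr q : R) -> forall w, regular w -> tau k w <= ratr q < tau k.+1 w ->
      ((pi w < (ratr q)%:E)%E <-> A' w)).
  move=> q; have [q0|q0] := ltP 0 (ratr q : R); last first.
    by exists set0; split=> //; rewrite ltNge q0.
  have [A' mA' A'E] := filtration_past k (stopping_time_lt spi q0).
  by exists A'.
have pM : measurable (M : set (past k)).
  exact: past_full.
(* At tau_k the distance to tau_{k+1} is not yet known; a window of unspecified width 1/(n + 1)
   takes its place. *)
rewrite (_ : _ `&` _ = M `&` \bigcup_n [set w | forall q : rat,
    (tau k w < ratr q /\ ratr q < tau k w + n.+1%:R^-1) -> A' q w]); last first.
  apply/seteqP; split => w.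
    move=> [/= piw Mw]; split=> //; have [x01 e0 _] := Mreg _ Mw.
    have tt : 0 < tau k.+1 w - tau k w by rewrite subr_gt0 record_time_lt.
    exists (Num.trunc (tau k.+1 w - tau k w)^-1) => // q [q1 q2].
    have q0 : 0 < ratr q :> R by rewrite (le_lt_trans _ q1)// record_time_ge0.
    apply/((A'P q).2 q0 w (Mreg _ Mw)).
      rewrite (ltW q1)/= (lt_trans q2)// -ltrBrDl invf_plt ?posrE//.
      exact: truncnS_gt.
    by rewrite (le_lt_trans piw)// lte_fin.
  move=> [Mw [n _ /= An]]; split=> //=; have [x01 e0 _] := Mreg _ Mw.
  rewrite leNgt; apply/negP => tpi.
  have [b tb bpi] : exists2 b, tau k w < b & (b%:E <= pi w)%E.
    case: (pi w) tpi => [b| |]//=; first by exists b.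
    by exists (tau k w + 1); rewrite ?ltrDl ?leey.
  (* A rational below all three bounds lies in the window, is described by the past, and still
     precedes [pi]. *)
  have : tau k w < Num.min b (Num.min (tau k.+1 w) (tau k w + n.+1%:R^-1)).
    by rewrite !lt_min tb record_time_lt//= ltrDl invr_gt0.
  move=> /rat_in_itvoo[q]; rewrite in_itv/= !lt_min => /and4P[q1 qb q2 q3].
  have q0 : 0 < ratr q :> R by rewrite (le_lt_trans _ q1)// record_time_ge0.
  have /((A'P q).2 q0 w (Mreg _ Mw)) : A' q w by exact: An.
  rewrite (ltW q1) q2 => /(_ isT)/(le_lt_trans bpi).
  by rewrite lte_fin ltNge (ltW qb).
apply: measurableI => //; apply: bigcup_measurable => n _.
have mt := @past_record_time k.
apply: measurable_forall_rat => q; apply: measurable_imply; last exact: (A'P q).1.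
by apply: measurableI; apply: measurable_ltr_set => //; exact: measurable_funD.
Qed.

End stopping_in_past.

(** * Optimality *)

(** Summation by parts: the sum of f_{k+1} - g_k is the sum of f_{k+1} - g_{k+1} plus g_n - g_0. The
    terms -g_0 and -g'_n have the favourable sign, g'_0 vanishes, and g_n stays as the error. *)
Lemma telescope_compare (R : realType) (f g f' g' : nat -> R) n :
    (forall k, f k.+1 - g k.+1 <= f' k.+1 - g' k.+1) ->
    0 <= g 0 -> g' 0 = 0 -> 0 <= g' n ->
  \sum_(k < n) (f k.+1 - g k) <= \sum_(k < n) (f' k.+1 - g' k) + g n.
Proof.
move=> fg g0 g'0 g'n.
have : \sum_(k < n) (f k.+1 - g k) + g 0 - g n <= \sum_(k < n) (f' k.+1 - g' k) - g' n.
  elim: n {g'n} => [|n IH]; first by rewrite !big_ord0 g'0; lra.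
  by rewrite !big_ord_recr/=; have := fg n; lra.
by lra.
Qed.

Section optimality.
Context d (Omega : measurableType d) (R : realType) (P : probability Omega R).
Variables (X_ E_ : nat -> {RV P >-> R}) (mX m : probability R R).
Hypothesis lawX : forall j A, measurable A -> P (X_ j @^-1` A) = mX A.
Hypothesis lawE : forall j A, measurable A -> P (E_ j @^-1` A) = m A.
Hypothesis indep : mutually_independent
  (fun i : nat + nat => match i with inl j => X_ j | inr j => E_ j end).
Hypothesis mX01 : mX `]0, 1[%classic = 1%E.
Hypothesis mE : forall A, measurable A -> m A = exponential_prob 1 A.
Variable s : R.
Hypotheses (s_gt0 : 0 < s) (Phi_s : Phi mX s = 1).

Variables (r0 T : R) (Rp : R -> {RV P >-> R}).
Hypotheses (r0_gt0 : 0 < r0) (T_gt0 : 0 < T).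
Hypothesis Rp_gt0 : forall w t, 0 <= t -> 0 < Rp t w.
Hypothesis Rp_noninc : forall w s t, 0 <= s -> s <= t -> Rp t w <= Rp s w.
Hypothesis Rp_jump : forall w, jump_path (Rp ^~ w).

Variable M : set Omega.
Hypotheses (mM : measurable M) (M1 : P M = 1%E) (Mreg : M `<=` regular X_ E_ r0 Rp).

Local Notation past := (past X_ E_).
Local Notation tau k w := (record_time r0 (X_ ^~ w) (E_ ^~ w) k).
Local Notation rho k w := (record_state r0 (X_ ^~ w) k).

Let S k w := (T - tau k w) * rho k w.

Definition last_at k : set Omega := M `&` [set w | tau k w < T < tau k.+1 w].

Definition region k : set Omega := M `&` [set w | tau k w < T /\ S k w <= s].

Let p A : R := fine (P A).

Let pastS k : measurable_fun setT (S k : past k -> R).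
Proof.
apply: measurable_funM; last exact: past_record_state.
by apply: measurable_funB => //; exact: past_record_time.
Qed.

Let past_lt k : measurable ([set w | tau k w < T] : set (past k)).
Proof. by apply: measurable_ltr_set => //; exact: past_record_time. Qed.

Let pastM k : measurable (M : set (past k)).
Proof. exact: past_full. Qed.

Let past_region k : measurable (region k : set (past k)).
Proof.
apply: measurableI => //; apply: measurableI => //.
exact: measurable_ler_set.
Qed.

Let measurable_last_at k : measurable (last_at k).
Proof.
apply: measurableI => //.
rewrite (_ : [set _ | _] = [set w | tau k w < T] `&` [set w | T < tau k.+1 w]); last first.
  by apply/seteqP; split => w /=; [move=> /andP[]|move=> [-> ->]].
apply: measurableI; first exact: (past_measurable (past_lt (k := k))).
apply: (@past_measurable _ _ _ _ X_ E_ k.+1).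
by apply: measurable_ltr_set => //; exact: past_record_time.
Qed.

Let last_at_quiet k w : M w -> tau k w < T ->
  last_at k w <-> quiet (S k w) (next_draws X_ E_ k w).
Proof.
move=> Mw kT; have [x01 e0 _] := Mreg Mw.
have rk := record_state_gt0 r0_gt0 x01 k.
rewrite /last_at/quiet/= kT/= record_timeS.
by rewrite -ltrBlDl ltr_pdivlMr//; split=> // -[].
Qed.

Let last_at_single k w : M w -> tau k w < T ->
  last_at k.+1 w <-> single (S k w) (next_draws X_ E_ k w).
Proof.
move=> Mw kT; have [x01 e0 _] := Mreg Mw.
have rk := record_state_gt0 r0_gt0 x01 k.
have rk1 := record_state_gt0 r0_gt0 x01 k.+1.
rewrite /last_at/single/= -(scaled_timeS _ r0_gt0 x01).
rewrite (record_timeS _ _ (E_ ^~ w) k.+1) -ltrBlDl ltr_pdivlMr// record_timeS.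
rewrite -ltrBrDl ltr_pdivrMr//.
by split=> [[_ /andP]|[h1 h2]]//; split=> //; apply/andP.
Qed.

Let p_split A B : measurable A -> measurable B -> p A = p (A `\` B) + p (A `&` B).
Proof.
move=> mA mB; rewrite /p -fineD ?fin_num_measure//; first by congr fine; exact: measureDI.
- exact: measurableD.
- exact: measurableI.
Qed.

Let p_le A B : measurable A -> measurable B -> A `<=` B -> p A <= p B.
Proof.
move=> mA mB AB; apply: fine_le; rewrite ?fin_num_measure//.
by apply: le_measure; rewrite ?inE.
Qed.

(* Conditionally on the past, the difference on the left is
   exp(-S)(1 - phi(S)), which is nonnegative exactly when S <= s. *)
Lemma region_maximizes k (C : set Omega) : measurable (C : set (past k)) ->
  p (C `&` last_at k) - p (C `&` last_at k.+1) <=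
  p (region k `&` last_at k) - p (region k `&` last_at k.+1).
Proof.
move=> pC; have mC := past_measurable pC; have mL := measurable_last_at.
have mB : measurable (region k) := past_measurable (past_region (k := k)).
(* The part common to [C] and [region k] contributes equally to both sides. It remains to see that
   what [C] has in excess loses and that what it lacks gains. *)
pose outC := C `&` (M `&` [set w | tau k w < T /\ s < S k w]).
pose inB := region k `\` C.
have poutC : measurable (outC : set (past k)).
  apply: measurableI => //; apply: measurableI => //; apply: measurableI => //.
  exact: measurable_ltr_set.
have pinB : measurable (inB : set (past k)) by exact: measurableD.
have eventE (A : set Omega) (e e' : set Omega) : A `<=` M `&` [set w | tau k w < T] ->
    (forall w, M w -> tau k w < T -> e w <-> e' w) -> A `&` e = A `&` e'.
  move=> AM ee'; apply/seteqP; split => w [Aw ew]; split=> //;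
    by have [Mw kT] := AM _ Aw; apply/(ee' _ Mw kT).
have outCM : outC `<=` M `&` [set w | tau k w < T] by move=> w [_ [Mw [kT _]]].
have inBM : inB `<=` M `&` [set w | tau k w < T] by move=> w [[Mw [kT _]] _].
have outC_le : p (outC `&` last_at k) <= p (outC `&` last_at k.+1).
  rewrite /p (eventE _ _ _ outCM (last_at_quiet (k := k))).
  rewrite (eventE _ _ _ outCM (last_at_single (k := k))).
  have mout : measurable outC := past_measurable poutC.
  apply: fine_le.
  - rewrite -(eventE _ _ _ outCM (last_at_quiet (k := k))) fin_num_measure//.
    exact: measurableI.
  - rewrite -(eventE _ _ _ outCM (last_at_single (k := k))) fin_num_measure//.
    exact: measurableI.
  apply: (quiet_le_single lawX lawE indep poutC (pastS (k := k)) mX01 mE s_gt0 Phi_s).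
  by move=> w [_ [_ []]].
have inB_le : p (inB `&` last_at k.+1) <= p (inB `&` last_at k).
  rewrite /p (eventE _ _ _ inBM (last_at_quiet (k := k))).
  rewrite (eventE _ _ _ inBM (last_at_single (k := k))).
  have min : measurable inB := past_measurable pinB.
  apply: fine_le.
  - rewrite -(eventE _ _ _ inBM (last_at_single (k := k))) fin_num_measure//.
    exact: measurableI.
  - rewrite -(eventE _ _ _ inBM (last_at_quiet (k := k))) fin_num_measure//.
    exact: measurableI.
  apply: (single_le_quiet lawX lawE indep pinB (pastS (k := k)) mX01 mE Phi_s).
  move=> w [[Mw [kT Ss]] _]; rewrite Ss andbT mulr_gt0 ?subr_gt0//.
  by have [x01 _ _] := Mreg Mw; exact: record_state_gt0.
(* On [last_at l] with k <= l one has tau_k < T, so missing the region can only mean s < S k. *)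
have outCE l : (k <= l)%N -> (C `&` last_at l) `\` region k = outC `&` last_at l.
  move=> kl; apply/seteqP; split => w.
    move=> [[Cw [Mw /andP[lT Tl]]] nB]; have [x01 e0 _] := Mreg Mw.
    have kT : tau k w < T by rewrite (le_lt_trans _ lT)// record_time_le.
    split; last by split=> //; apply/andP.
    split=> //; split=> //; split=> //; rewrite ltNge; apply/negP => Ss.
    by apply: nB.
  move=> [[Cw [_ [_ sS]]] Lw]; split=> // -[_ [_]].
  by rewrite leNgt sS.
have CE l : (k <= l)%N ->
    p (C `&` last_at l) = p (outC `&` last_at l) + p (C `&` last_at l `&` region k).
  move=> kl; rewrite (p_split (B := region k)) ?outCE//.
  exact: measurableI.
have BE l : p (region k `&` last_at l) =
    p (inB `&` last_at l) + p (C `&` last_at l `&` region k).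
  rewrite (p_split (B := C))//; last exact: measurableI.
  congr (p _ + p _); last by rewrite setIC setIA setIAC setIA.
  by rewrite /inB setDE setIAC -setDE.
rewrite !CE// !BE.
have arith (a1 a2 a3 a4 a5 a6 : R) : a1 <= a2 -> a4 <= a3 ->
  a1 + a5 - (a2 + a6) <= a3 + a5 - (a4 + a6) by lra.
exact: arith.
Qed.

Let p_bigsetU (F : nat -> set Omega) n : (forall k, measurable (F k)) -> trivIset setT F ->
  p (\big[setU/set0]_(k < n) F k) = \sum_(k < n) p (F k).
Proof.
move=> mF tF; rewrite /p measure_bigsetU//.
by rewrite -sum_fine// => k _; rewrite fin_num_measure.
Qed.

Let p_setD A B : measurable A -> measurable B -> B `<=` A -> p (A `\` B) = p A - p B.
Proof.
move=> mA mB BA; rewrite (p_split mA mB) (_ : A `&` B = B) ?addrK//.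
exact/setIidPr.
Qed.

Let p_full A : measurable A -> p (A `&` M) = p A.
Proof. by move=> mA; rewrite /p (probability_setI_full mA mM M1). Qed.

Definition late n : set Omega := M `&` [set w | tau n.+1 w < T].

Let measurable_late n : measurable (late n).
Proof. by apply: measurableI => //; exact: (past_measurable (past_lt (k := n.+1))). Qed.

Let last_at_inj k l w : last_at k w -> last_at l w -> k = l.
Proof.
move=> [Mw /andP[kT Tk]] [_ /andP[lT Tl]]; have [x01 e0 _] := Mreg Mw.
by apply: (record_index_unique r0_gt0 x01 e0 (t := T)); rewrite (ltW, ltW).
Qed.

Let trivIset_last_at (F : nat -> set Omega) : (forall k, F k `<=` last_at k.+1) ->
  trivIset setT F.
Proof.
move=> FL; apply/trivIsetP => i j _ _ /eqP ij; apply/seteqP; split => w //=.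
move=> [/FL Li /FL Lj]; apply: ij.
by have [] := last_at_inj Li Lj.
Qed.

(** Cutting the sums at [n] makes two errors, each at most [p (late n)]: successes of [pi] at
    records beyond the n-th, and the boundary term of the telescoping sum. *)
Lemma recognition_le pi n : stopping_time Rp pi ->
  p (recognises_last_record Rp T pi) <=
  p (recognises_last_record Rp T (threshold_policy Rp T s)) + 2 * p (late n).
Proof.
move=> spi; set rho := threshold_policy Rp T s.
have mRp t : measurable_fun setT (Rp t) by [].
have mwin : measurable (recognises_last_record Rp T pi).
  exact: measurable_recognises.
have mwin' : measurable (recognises_last_record Rp T rho).
  by apply: measurable_recognises => //; exact: threshold_stopping_time.
pose C k := [set w | (pi w <= (tau k w)%:E)%E] `&` M.
have pC k : measurable (C k : set (past k)) by exact: (stopped_past r0_gt0 Rp_jump spi mM M1 Mreg).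
have mC k : measurable (C k) := past_measurable (pC k).
have CS k : C k `<=` C k.+1.
  move=> w [/= pk Mw]; split=> //=; apply: (le_trans pk).
  have [x01 e0 _] := Mreg Mw.
  by rewrite lee_fin ltW// record_time_lt.
have mregion k : measurable (region k) := past_measurable (past_region (k := k)).
(* Time 0 is not a record, so the threshold policy cannot stop there even when [region 0] is not
   empty. *)
pose B k := if k is 0%N then set0 else region k.
have mB k : measurable (B k).
  by case: k => [|k]; [exact: measurable0|exact: mregion].
(* [W k] may exceed the success of [pi] at tau_{k+1}, since [pi] may stop between two records; an
   upper bound is enough for [pi]. For the threshold policy a lower bound is needed, and [V k] lies
   inside its success event. *)
pose W k := (C k.+1 `&` last_at k.+1) `\` (C k `&` last_at k.+1).
pose V k := (region k.+1 `&` last_at k.+1) `\` (B k `&` last_at k.+1).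
have WE k : p (W k) = p (C k.+1 `&` last_at k.+1) - p (C k `&` last_at k.+1).
  by apply: p_setD; [exact: measurableI|exact: measurableI|apply: setSI].
have BS k : B k `&` last_at k.+1 `<=` region k.+1 `&` last_at k.+1.
  case: k => [|k] w [//=]; move=> [Mw [kT Ss]] Lw; split=> //; split=> //.
  have [x01 e0 _] := Mreg Mw; move: Lw => [_ /andP[kT' _]]; split=> //.
  exact: (scaled_time_le r0_gt0 x01 e0 (leqnSn k.+1)).
have VE k : p (V k) = p (region k.+1 `&` last_at k.+1) - p (B k `&` last_at k.+1).
  by apply: p_setD => //; exact: measurableI.
have mW k : measurable (W k) by apply: measurableD; exact: measurableI.
have mV k : measurable (V k).
  by apply: measurableD; exact: measurableI.
have tW : trivIset setT W by apply: trivIset_last_at => k w [[]].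
have tV : trivIset setT V by apply: trivIset_last_at => k w [[]].
have p_ge0 A : 0 <= p A by exact: fine_ge0.
have pU A A' : measurable A -> measurable A' -> p (A `|` A') <= p A + p A'.
  move=> mA mA'; rewrite /p -fineD ?fin_num_measure//.
  apply: fine_le; rewrite ?fin_numD ?fin_num_measure//; first exact: measurableU.
  exact: measureU2.
have winE w (q : \bar R) : M w ->
    (exists t : R, [/\ q = t%:E, is_record (Rp ^~ w) t, Rp t w = Rp T w & t < T]) <->
    exists2 k, q = (tau k.+1 w)%:E & tau k.+1 w < T < tau k.+2 w.
  move=> Mw; have [x01 e0 RpE] := Mreg Mw.
  exact: (recognises_record_time r0_gt0 x01 e0 (Rp_jump w) (@Rp_noninc w) RpE q T_gt0).
have mUW : measurable (\big[setU/set0]_(k < n) W k) by exact: bigsetU_measurable.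
have mUV : measurable (\big[setU/set0]_(k < n) V k) by exact: bigsetU_measurable.
have winW : p (recognises_last_record Rp T pi) <= \sum_(k < n) p (W k) + p (late n).
  rewrite -(p_full mwin) -(p_bigsetU n mW tW); apply: le_trans (pU _ _ mUW (measurable_late n)).
  apply: p_le; [exact: measurableI|exact: measurableU|].
  move=> w [/[swap] Mw /(winE w _ Mw)[k pik kT]]; have [x01 e0 _] := Mreg Mw.
  have [kn|nk] := ltnP k n; [left|right].
    rewrite -bigcup_mkord; exists k => //; split.
      by split; [split=> //=; rewrite pik|split].
    by move=> [[/= + _] _]; rewrite pik lee_fin leNgt record_time_lt.
  split=> //=; move/andP: kT => [kT _]; apply: le_lt_trans kT.
  exact: record_time_le.
have Vwin : \sum_(k < n) p (V k) <= p (recognises_last_record Rp T rho).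
  rewrite -(p_bigsetU n mV tV); apply: p_le => //.
  rewrite -bigcup_mkord => w [k _ [[[Mw [kT Ss]] Lw] nB]].
  have [x01 e0 RpE] := Mreg Mw.
  apply/(winE w _ Mw); exists k; last by case: Lw.
  apply: (first_record_in_region r0_gt0 x01 e0 (Rp_jump w) (@Rp_noninc w) RpE kT Ss).
  case: k nB kT {Ss} Lw => [|k]// nB kT Lw _; rewrite ltNge; apply/negP => Ss.
  by apply: nB; split=> //; split=> //; split=> //; apply: lt_trans kT; exact: record_time_lt.
have Clate : p (C n `&` last_at n.+1) <= p (late n).
  apply: p_le => //; first exact: measurableI.
  by move=> w [_ [Mw /andP[nT _]]].
have tel : \sum_(k < n) p (W k) <= \sum_(k < n) p (V k) + p (C n `&` last_at n.+1).
  under eq_bigr do rewrite WE.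
  under [in leRHS]eq_bigr do rewrite VE.
  apply: (telescope_compare (f := fun k => p (C k `&` last_at k))
    (g := fun k => p (C k `&` last_at k.+1)) (f' := fun k => p (region k `&` last_at k))
    (g' := fun k => p (B k `&` last_at k.+1))) => //.
    by move=> k; exact: region_maximizes.
  by rewrite set0I /p measure0.
have arith (a b c e f : R) : a <= b + c -> e <= f -> b <= e + c -> a <= f + 2 * c by lra.
apply: (arith _ _ _ _ _ winW Vwin); apply: (le_trans tel); by rewrite lerD2l.
Qed.

(** The events decrease, and a path in all of them would have infinitely many jumps before T, which
    [record_time_cover] excludes. *)
Lemma late_cvg : p (late n) @[n --> \oo] --> 0.
Proof.
have lateT : \bigcap_n late n = set0.
  apply/seteqP; split => w // lw; have [Mw _] := lw 0%N Logic.I.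
  have [x01 e0 RpE] := Mreg Mw.
  have [k /andP[_ Tk]] := record_time_cover r0_gt0 x01 e0 (Rp_jump w) RpE (ltW T_gt0).
  by have [_ /=] := lw k Logic.I; rewrite ltNge (ltW Tk).
have : P (late n) @[n --> \oo] --> P (\bigcap_n late n).
  apply: nonincreasing_cvg_mu => //.
  - by rewrite (le_lt_trans (probability_le1 P _))// ltry.
  - by rewrite lateT.
  - move=> i j ij; apply/subsetPset => w [Mw /= jT]; split=> //=; apply: le_lt_trans jT.
    by have [x01 e0 _] := Mreg Mw; exact: record_time_le.
by rewrite lateT measure0 => /fine_cvg.
Qed.

Lemma threshold_recognition_max pi : stopping_time Rp pi ->
  (P (recognises_last_record Rp T pi) <=
   P (recognises_last_record Rp T (threshold_policy Rp T s)))%E.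
Proof.
move=> spi; have mRp t : measurable_fun setT (Rp t) by [].
have mwin : measurable (recognises_last_record Rp T pi).
  exact: measurable_recognises.
have mwin' : measurable (recognises_last_record Rp T (threshold_policy Rp T s)).
  by apply: measurable_recognises => //; exact: threshold_stopping_time.
rewrite -[leLHS]fineK ?fin_num_measure// -[leRHS]fineK ?fin_num_measure// lee_fin.
apply/ler_addgt0Pr => e e0; have e20 : 0 < e / 2 by rewrite divr_gt0.
have /cvgrPdist_lt/(_ _ e20)[n _ /(_ n (leqnn n))] := late_cvg.
rewrite /= sub0r normrN ger0_norm ?fine_ge0// => late_e.
apply: (le_trans (recognition_le n spi)); rewrite lerD2l.
by rewrite mulrC -ler_pdivlMr// ltW.
Qed.

End optimality.

(** * From laws and almost sure statements to the theorem *)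

Lemma is_thresholdE d (Omega : measurableType d) (R : realType) (Q : probability Omega R)
    (X : {RV Q >-> R}) (s : R) : distribution Q X `]0, 1[%classic = 1%E ->
  is_threshold X s <-> 0 < s /\ Phi (distribution Q X) s = 1.
Proof.
move=> hX; suff EPhi : 0 < s ->
    'E_Q[(fun w => (expR (s * (1 - X w)) - 1) / (1 - X w))%R]%E = (Phi (distribution Q X) s)%:E.
  split=> -[s0 sE]; split=> //; last by rewrite EPhi// sE.
  by move: sE; rewrite EPhi// => -[].
move=> s0; rewrite -integral_phi//; last exact: ltW.
rewrite unlock ge0_integral_distribution//.
  by apply/measurable_EFinP; exact: measurable_phi.
by move=> y; rewrite lee_fin phi_ge0// ltW.
Qed.

Lemma full_event_of_ae d (Omega : measurableType d) (R : realType) (P : probability Omega R)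
    (Q : Omega -> Prop) : {ae P, forall w, Q w} ->
  exists M, [/\ measurable M, P M = 1%E & forall w, M w -> Q w].
Proof.
move=> [N [mN N0 QN]]; exists (~` N); split; first exact: measurableC.
  by rewrite [LHS]probability_setC// [X in (1 - X)%E]N0 sube0.
by move=> w nNw; apply: contrapT => nQ; apply: nNw; exact: QN.
Qed.

Lemma ae_of_full_event d (Omega : measurableType d) (R : realType) (P : probability Omega R)
    (A : set Omega) : measurable A -> P A = 1%E -> {ae P, forall w, A w}.
Proof.
move=> mA A1; exists (~` A); split => //; first exact: measurableC.
by rewrite [LHS]probability_setC// A1 subee.
Qed.

Theorem proposition1 (R : realType)
    (d' : measure_display) (Omega' : measurableType d')
    (Q : probability Omega' R) (X : {RV Q >-> R})
    (hX : distribution Q X `]0, 1[ = 1%E)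
    (d : measure_display) (Omega : measurableType d)
    (P : probability Omega R) (r0 T : R) (hr0 : 0 < r0) (hT : 0 < T)
    (Rp : R -> {RV P >-> R}) (hRp : is_record_process X r0 Rp) :
  (exists! s : R, is_threshold X s) /\
  (forall s : R, is_threshold X s ->
     optimal_policy P Rp T (threshold_policy Rp T s)).
Proof.
have thE s := is_thresholdE s hX.
split.
  have [s [sP s_uniq]] := threshold_exists_unique hX.
  exists s; split; first exact/thE.
  by move=> t /thE; exact: s_uniq.
move=> s /thE[s0 Phi_s]; have [_ Rgt0 Rnoninc Rjump] := hRp.
move=> [X_ [E_ [lawX lawE indep aeR]]].
split; first exact: threshold_stopping_time.
move=> pi spi.
(* The law of the first clock serves as the common law [m] of all of them. *)
have mE A : measurable A -> distribution P (E_ 0%N) A = exponential_prob 1 A.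
  exact: lawE.
have lawE' j A : measurable A -> P (E_ j @^-1` A) = distribution P (E_ 0%N) A.
  by move=> mA; rewrite (mE A mA); exact: lawE.
have aeX : {ae P, forall w, forall j, 0 < X_ j w < 1}.
  apply/ae_foralln => j; have := lawX j _ (measurable_itv `]0, 1[); rewrite hX => X1.
  have := ae_of_full_event (measurable_funPTI (X_ j) (measurable_itv `]0, 1[)) X1.
  by apply: filterS => w; rewrite /= in_itv.
have aeE : {ae P, forall w, forall j, 0 < E_ j w}.
  apply/ae_foralln => j.
  have E1 : P (E_ j @^-1` `]0, +oo[) = 1%E.
    have := lawE j _ (measurable_itv `]0, +oo[).
    by rewrite exponential_tail// oppr0 expR0.
  have := ae_of_full_event (measurable_funPTI (E_ j) (measurable_itv `]0, +oo[)) E1.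
  by apply: filterS => w; rewrite /= in_itv/= andbT.
(* The almost sure properties are gathered on one measurable event of full probability, which then
   belongs to every [past k]. *)
have [M [mM M1 Mreg]] : exists M, [/\ measurable M, P M = 1%E &
    forall w, M w -> regular X_ E_ r0 Rp w].
  by apply: full_event_of_ae; apply: filterS3 aeX aeE aeR => w.
exact: (threshold_recognition_max (mX := distribution Q X) (m := distribution P (E_ 0%N))
  lawX lawE' indep hX mE s0 Phi_s hr0 hT Rgt0 Rnoninc Rjump mM M1 Mreg spi).
Qed.
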